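(* Let $p\ge1$ be an integer. There exist $\mu_0>0$ and a family $\{\varphi_{1,p,\mu}:0<\mu<\mu_0\}\subset H^4(\mathbb{R})$ such that, for each $\mu\in\,]0,\mu_0[$, $\varphi_{1,p,\mu}$ is an even solution of $$\mu\partial_x^4\varphi-\partial_x^2\varphi+\varphi=\frac{1}{p+1}\varphi^{p+1}\quad\text{on }\mathbb{R},$$ and $$\lim_{\mu\to0^+}\|\varphi_{1,p,\mu}-\varphi_{1,p,0}\|_{H^1(\mathbb{R})}=0,$$ where $$\varphi_{1,p,0}(x)=\left[\frac{(p+1)(p+2)}{2}\right]^{1/p}\operatorname{sech}^{2/p}\left[\frac{p}{2}x\right],\quad x\in\mathbb{R}.$$
   Context: All functions are real-valued. The function $\varphi_{1,p,0}$ is the soliton of speed $1$ of the generalized Korteweg-de Vries equation; it solves $-\partial_x^2\varphi+\varphi=\frac{1}{p+1}\varphi^{p+1}$ on $\mathbb{R}$. *)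

(* Defs.v *)
From HB Require Import structures.
From mathcomp Require Import all_boot all_order all_algebra.
From mathcomp Require Import all_classical all_reals all_analysis.

Set Implicit Arguments.
Unset Strict Implicit.
Unset Printing Implicit Defensive.

Import Order.TTheory GRing.Theory Num.Theory.
Import numFieldNormedType.Exports.

Local Open Scope classical_set_scope.
Local Open Scope ring_scope.

Definition test_function (R : realType) (psi : R -> R) : Prop :=
  (forall n x, derivable (psi^`(n))%classic x 1) /\
  compact (closure [set x | psi x != 0]).

Definition is_weak_derivative (R : realType) (n : nat) (f g : R -> R) : Prop :=
  [/\ locally_integrable [set: R] f, locally_integrable [set: R] g &
      forall psi : R -> R, test_function psi ->
        \int[lebesgue_measure]_x (f x * (psi^`(n))%classic x) =
        (-1) ^+ n * \int[lebesgue_measure]_x (g x * psi x)].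

(* A choice of weak derivative of order n, which is unique only up to equality
   almost everywhere; the zero function if there is none. *)
Definition weak_derivative (R : realType) (n : nat) (f : R -> R) : R -> R :=
  xget (cst 0) [set g | is_weak_derivative n f g].

(* The space H^k(R); its elements are functions, not classes modulo
   almost-everywhere equality. *)
Definition sobolev_H (R : realType) (k : nat) : set (R -> R) :=
  [set f | f \in Lfun (@lebesgue_measure R) 2%:E /\
     forall n, (n <= k)%N -> exists g : R -> R,
       is_weak_derivative n f g /\ g \in Lfun (@lebesgue_measure R) 2%:E].

(* Only meaningful on sobolev_H R k, since weak_derivative is a total
   function. *)
Definition sobolev_norm (R : realType) (k : nat) (f : R -> R) : \bar R :=
  ((\sum_(n < k.+1)
      'N[lebesgue_measure]_2%:E[EFin \o weak_derivative n f] ^+ 2) `^ 2^-1)%E.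

Definition sech (R : realType) (x : R) : R := 2 / (expR x + expR (- x)).

Definition soliton (R : realType) (p : nat) (x : R) : R :=
  ((p%:R + 1) * (p%:R + 2) / 2) `^ p%:R^-1 *
  sech (p%:R / 2 * x) `^ (2 / p%:R).

Definition kawahara_solution (R : realType) (p : nat) (mu : R) (f : R -> R) :
    Prop :=
  {ae lebesgue_measure, forall x : R,
     mu * weak_derivative 4 f x - weak_derivative 2 f x + f x
     = (p%:R + 1)^-1 * f x ^+ p.+1}.

(* Main.v *)
Require Import Defs.
From HB Require Import structures.
From mathcomp Require Import all_boot all_order all_algebra.
From mathcomp Require Import all_classical all_reals all_analysis.
From mathcomp Require Import measurable_realfun ring lra.

(** The equation is a singular perturbation of the soliton equation, and the
    solution is found near the soliton [phi] by a contraction argument for a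
    regularised, second order form of the problem.  Let [N v] denote
    [v ^+ p.+1 / (p + 1)].

    For small [mu] the fourth order operator factors as
    [1 - D^2 + mu D^4 = (1 - s^-1 D^2) (1 - b^-2 D^2)] with [s] close to 1 and
    [b] of order [mu ^ (-1/2)] ([dispersion_parameters]).  The equation is thus
    [- v'' + s v = s J (N v)] with [J = (1 - b^-2 D^2)^-1], and [J] is close to
    the identity on functions with a bounded derivative: [J f - f] is linear in
    [f'] and of size [1 / b] ([corr], [resolvent]).  Writing [v = phi + h] and
    [L = - D^2 + 1 - phi ^+ p] for the linearised operator, one has to solve
    [L h = r] with the source
    [r = Q h + s (J - 1) (N v) + (s - 1) (N v - v)], where [Q] is quadratic.

    On even functions [L] is invertible, since its kernel is spanned by the odd
    function [phi'].  The inverse is explicit: besides [phi'] there is a second,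
    even and growing, solution of [L u = 0], which is elementary up to one
    integration ([even_mode]), and variation of constants gives an inverse that
    gains derivatives and preserves exponential decay ([green], [green_dist]).
    Taking the source [r] as the unknown makes [h] automatically differentiable,
    which is what the estimate of [J - 1] requires; the right-hand side is then a
    contraction of a ball of radius [O (sqrt mu)] in a space of even continuous
    functions with an exponential weight ([weighted_fixed_point],
    [profile_solution]).

    All estimates of integrals are comparison arguments: a function vanishing at
    infinity whose derivative is dominated by that of a barrier is dominated by
    the barrier ([tail_comparison]).  The barriers are multiples of the smooth
    weight [wgt], whose logarithmic derivative is at most [1 / 2].

    The solution has four continuous derivatives bounded by multiples of the
    weight, and the weight is square integrable.  Integration by parts turns
    these into weak derivatives, and weak derivatives are unique almost
    everywhere ([weak_derivative_unique], by testing against smooth bumps), so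
    that the chosen weak derivatives in the equation and in the Sobolev norm may
    be replaced by the classical ones. *)

Set Implicit Arguments.
Unset Strict Implicit.
Unset Printing Implicit Defensive.

Import Order.TTheory GRing.Theory Num.Theory.
Import numFieldNormedType.Exports.

Local Open Scope classical_set_scope.
Local Open Scope ring_scope.

(** * Everywhere differentiable functions on the line *)

Section DerivativeRelation.
Variable R : realType.
Implicit Types f g : R -> R.

Definition drv f g := forall x : R, is_derive x (1 : R) f (g x).

Lemma drv_ext f g g' : drv f g -> (forall x, g x = g' x) -> drv f g'.
Proof. by move=> fg e x; rewrite -e. Qed.

Lemma drv_cst c : drv (fun _ => c) (fun _ => 0).
Proof. by move=> x; exact: is_derive_cst. Qed.

Lemma drv_id : drv (fun x => x) (fun _ => 1).
Proof. by move=> x; exact: is_derive_id. Qed.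

Lemma drvD f g f' g' : drv f f' -> drv g g' ->
  drv (fun x => f x + g x) (fun x => f' x + g' x).
Proof. by move=> df dg x; exact: is_deriveD. Qed.

Lemma drvN f f' : drv f f' -> drv (fun x => - f x) (fun x => - f' x).
Proof. by move=> df x; exact: is_deriveN. Qed.

Lemma drvB f g f' g' : drv f f' -> drv g g' ->
  drv (fun x => f x - g x) (fun x => f' x - g' x).
Proof. by move=> df dg; apply: drvD => //; exact: drvN. Qed.

Lemma drvM f g f' g' : drv f f' -> drv g g' ->
  drv (fun x => f x * g x) (fun x => f' x * g x + f x * g' x).
Proof.
move=> df dg x; have := @is_deriveM _ _ f g x 1 _ _ (df x) (dg x).
by move/is_derive_eq; apply; rewrite /GRing.scale /= addrC mulrC.
Qed.

Lemma drvZ c f f' : drv f f' -> drv (fun x => c * f x) (fun x => c * f' x).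
Proof.
move=> df; apply: drv_ext; first exact: (drvM (drv_cst c) df).
by move=> x /=; rewrite mul0r add0r.
Qed.

Lemma drv_comp f g f' g' : drv f f' -> drv g g' ->
  drv (fun x => f (g x)) (fun x => g' x * f' (g x)).
Proof.
move=> df dg x.
rewrite mulrC; exact: (@is_derive1_comp R f g x (f' (g x)) (g' x) (df (g x)) (dg x)).
Qed.

Lemma drv_expR f f' : drv f f' ->
  drv (fun x => expR (f x)) (fun x => f' x * expR (f x)).
Proof.
by move=> df; exact: (@drv_comp expR f expR f' (@is_derive_expR R) df).
Qed.

Lemma drvV f f' : (forall x, f x != 0) -> drv f f' ->
  drv (fun x => (f x)^-1) (fun x => - f' x / f x ^+ 2).
Proof.
move=> f0 df x; have := @is_deriveV _ f x (f' x) 1 (f0 x) (df x).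
by move/is_derive_eq; apply; rewrite /GRing.scale /=; field; exact: f0.
Qed.

Lemma drvX n f f' : drv f f' ->
  drv (fun x => f x ^+ n.+1) (fun x => n.+1%:R * f x ^+ n * f' x).
Proof.
move=> df x; rewrite -exprfctE; exact: (@is_deriveX _ _ f n.+1 x 1 (f' x) (df x)).
Qed.

Lemma drv_opp_arg f f' : drv f f' -> drv (fun x => f (- x)) (fun x => - f' (- x)).
Proof.
move=> df; apply: drv_ext; first exact: (drv_comp df (drvN drv_id)).
by move=> x /=; rewrite mulN1r.
Qed.

Lemma drv_derivable f f' x : drv f f' -> derivable f x 1.
Proof. by move=> df; have [] := df x. Qed.

Lemma drv_derive1 f f' : drv f f' -> f^`()%classic = f'.
Proof. by move=> df; apply/funext => x; rewrite derive1E; have [] := df x. Qed.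

Lemma drv_continuous f f' : drv f f' -> continuous f.
Proof.
move=> df x; apply/differentiable_continuous/derivable1_diffP.
exact: drv_derivable df.
Qed.

Lemma contM f g : continuous f -> continuous g -> continuous (fun x => f x * g x).
Proof. by move=> cf cg x; apply: (@continuousM R R f g x); [exact: cf|exact: cg]. Qed.

Lemma contD f g : continuous f -> continuous g -> continuous (fun x => f x + g x).
Proof. by move=> cf cg x; apply: (@continuousD R R R f g x); [exact: cf|exact: cg]. Qed.

Lemma contB f g : continuous f -> continuous g -> continuous (fun x => f x - g x).
Proof. by move=> cf cg x; apply: (@continuousB R R R f g x); [exact: cf|exact: cg]. Qed.

Lemma contX n f : continuous f -> continuous (fun x => f x ^+ n).
Proof.
move=> cf; elim: n => [|n IH]; first by move=> x; exact: cvg_cst.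
rewrite (_ : (fun x => _) = fun x => f x * f x ^+ n); first exact: contM.
by apply/funext => x; rewrite exprS.
Qed.

Lemma drv_MVT f f' a b : drv f f' -> a <= b ->
  exists2 c, a <= c <= b & f b - f a = f' c * (b - a).
Proof.
move=> df ab; have [||c] := @MVT_segment R f f' a b ab.
- by move=> x _; exact: df.
- by apply: continuous_subspaceT; exact: drv_continuous df.
by rewrite in_itv /= => cab e; exists c.
Qed.

Lemma drv_ge0 f f' a : drv f f' -> (forall x, a <= x -> 0 <= f' x) ->
  forall x y, a <= x -> x <= y -> f x <= f y.
Proof.
move=> df f0 x y ax xy; have [c /andP[xc _]] := drv_MVT df xy.
move=> e; rewrite -subr_ge0 e mulr_ge0 ?subr_ge0 //.
by apply: f0; exact: le_trans xc.
Qed.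

Lemma drv_eq f g f' a : drv f f' -> drv g f' -> f a = g a -> forall x, f x = g x.
Proof.
move=> df dg e x; have D0 : drv (fun y => f y - g y) (fun _ => 0).
  by apply: (drv_ext (drvB df dg)) => y; rewrite subrr.
apply/eqP; rewrite -subr_eq0; apply/eqP.
by have := @is_derive_0_is_cst R _ x a D0; rewrite e subrr.
Qed.

(** Existence of primitives: the integral from a base point to the left of
    [x] has the required derivative at [x]; subtracting its value at [0] makes
    the result independent of the base point, so one may move the base point
    with [x]. *)
Lemma primitive_exists f : continuous f -> exists2 F, drv F f & F 0 = 0.
Proof.
move=> cf; pose mu := @lebesgue_measure R.
pose I (a x : R) : R := \int[mu]_(t in `[a, x]) f t.
have dI (a x : R) : a < x -> is_derive x 1 (I a) (f x).
  move=> ax.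
  have intf : mu.-integrable `[a, x + 1] (EFin \o f).
    apply: continuous_compact_integrable; first exact: segment_compact.
    exact: continuous_subspaceT.
  have xx1 : x < x + 1 by rewrite ltrDl.
  have [dF <-] := @continuous_FTC1_closed R f a x (x + 1) xx1 intf ax (cf x).
  by rewrite derive1E; exact: derivableP.
pose F (n x : R) : R := I (- n) x - I (- n) 0.
have dF (n x : R) : - n < x -> is_derive x 1 (F n) (f x).
  move=> nx; rewrite -[f x]subr0; apply: (@is_deriveB _ _ _ (I (- n)) (cst _)).
  exact: dI.
have FF (n m x : R) : 0 < n -> n <= m -> - n < x -> F n x = F m x.
  move=> n0 nm nx; pose D y := F n y - F m y.
  have dD (y : R) : - n < y -> is_derive y 1 D 0.
    move=> ny; rewrite -[0](subrr (f y)); apply: is_deriveB; apply: dF => //.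
    by apply: le_lt_trans ny; rewrite lerN2.
  have D0 : D 0 = 0 by rewrite /D /F !subrr.
  suff : D x = 0 by move/eqP; rewrite subr_eq0 => /eqP.
  have main (a b : R) : - n < a -> a <= b -> D b = D a.
    move=> na ab; have [||c _] := @MVT_segment R D (cst 0) a b ab.
    - by move=> y; rewrite in_itv /= => /andP[ay _]; apply: dD; exact: lt_trans ay.
    - apply: continuous_in_subspaceT => y; rewrite inE /= in_itv /= => /andP[ay _].
      apply/differentiable_continuous/derivable1_diffP.
      by have [] := dD y (lt_le_trans na ay).
    by rewrite mul0r => /eqP; rewrite subr_eq0 => /eqP.
  case: (leP 0 x) => x0; first by rewrite (main 0 x) // oppr_lt0.
  by rewrite -(main x 0) // ltW.
exists (fun x => F (`|x| + 1) x); last by rewrite /F subrr.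
move=> x; apply: (@near_eq_is_derive _ _ _ (F (`|x| + 2))); last first.
  by apply: dF; have := ler_norm (- x); rewrite normrN; lra.
near=> y.
have yx : `|y - x| < 1.
  near: y; apply: (@cvgr_distC_lt _ _ _ (nbhs x) _ id x) => //; exact: cvg_id.
have := ler_normD (y - x) x; rewrite subrK => le1.
apply/esym/FF; [|lra|].
  by have := normr_ge0 y; lra.
by have := ler_norm (- y); rewrite normrN; lra.
Unshelve. all: by end_near. Qed.

End DerivativeRelation.

(** * Primitives vanishing at the origin and at infinity *)

Section Primitives.
Variable R : realType.
Implicit Types f g F V v : R -> R.

Lemma nincr_cvg0_ge0 F (a : R) :
  (forall x y, a <= x -> x <= y -> F y <= F x) ->
  F x @[x --> +oo] --> 0 -> forall x, a <= x -> 0 <= F x.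
Proof.
move=> dF F0 x ax; rewrite leNgt; apply/negP => Fx.
have /cvgrPdist_lt/(_ (- F x)) := F0; rewrite oppr_gt0 => /(_ Fx) near_small.
near (pinfty_nbhs R) => y.
have : `|0 - F y| < - F x by near: y.
have : F y <= F x by apply: dF => //; near: y; exact: nbhs_pinfty_ge.
by rewrite sub0r normrN; have := ler_norm (- F y); rewrite normrN; lra.
Unshelve. all: by end_near. Qed.

(** Comparison principle replacing estimates of integrals over [[x, +oo[]:
    [V + F] and [V - F] are nonincreasing and vanish at infinity. *)
Lemma tail_comparison F f V v (a : R) : drv F f -> drv V v ->
  F x @[x --> +oo] --> 0 -> V x @[x --> +oo] --> 0 ->
  (forall x, a <= x -> `|f x| <= - v x) -> forall x, a <= x -> `|F x| <= V x.
Proof.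
move=> dF dV F0 V0 fv x ax.
have key (e : R) : `|e| = 1 -> 0 <= V x - e * F x.
  move=> e1; apply: (@nincr_cvg0_ge0 (fun y => V y - e * F y) a) => //.
    move=> y z ay yz; rewrite -lerN2.
    apply: (drv_ge0 (drvN (drvB dV (drvZ e dF))) _ ay yz) => t /fv ft.
    have := ler_norm (- (e * f t)); rewrite normrN normrM e1 mul1r; lra.
  by rewrite -[0](subrr 0) -[X in _ - X](mulr0 e); apply: cvgB => //; exact: cvgMr.
have := key 1; have := key (-1); rewrite normrN normr1 => /(_ erefl) h1 /(_ erefl) h2.
by rewrite ler_norml; apply/andP; split; lra.
Qed.

(** With the bound of [tail_comparison], [G - V] is nondecreasing and bounded
    above by [G a + V a] for every primitive [G] of [f], so that [G] converges
    at infinity. *)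
Lemma tail_exists f V v (a : R) : continuous f -> drv V v ->
  V x @[x --> +oo] --> 0 -> (forall x, a <= x -> `|f x| <= - v x) ->
  exists2 F, drv F (fun x => - f x) & F x @[x --> +oo] --> 0.
Proof.
move=> cf dV V0 fv; have [G dG _] := primitive_exists cf.
have up : forall x y, a <= x -> x <= y -> G x - V x <= G y - V y.
  apply: (drv_ge0 (drvB dG dV)) => x /fv; rewrite ler_norml => /andP[]; lra.
have dn : forall x y, a <= x -> x <= y -> - (G x + V x) <= - (G y + V y).
  apply: (drv_ge0 (drvN (drvD dG dV))) => x /fv; rewrite ler_norml => /andP[]; lra.
have Vge0 x : a <= x -> 0 <= V x.
  apply: nincr_cvg0_ge0 => // y z ay yz.
  by have := up y z ay yz; have := dn y z ay yz; lra.
pose H x := G (Num.max a x) - V (Num.max a x).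
have Hnd : nondecreasing_fun H.
  move=> x y xy; apply: up; first by rewrite le_max lexx.
  by rewrite ge_max !le_max lexx xy orbT.
have Hub : has_ubound (range H).
  exists (G a + V a) => _ [x _ <-]; rewrite /H.
  have am : a <= Num.max a x by rewrite le_max lexx.
  by have := dn _ _ (lexx a) am; have := Vge0 _ am; lra.
have cH := nondecreasing_cvgr Hnd Hub; set l := sup _ in cH.
exists (fun x => l - G x).
  by apply: drv_ext; [exact: (drvB (drv_cst l) dG)|move=> x /=; rewrite sub0r].
have -> : 0 = l - (l + 0) by rewrite addr0 subrr.
apply: cvgB; first exact: cvg_cst.
apply: cvg_trans (cvgD cH V0); apply: near_eq_cvg; near=> x.
rewrite fctE /H (_ : Num.max a x = x) ?subrK //.
by apply: max_r; near: x; apply: nbhs_pinfty_ge; exact: num_real.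
Unshelve. all: by end_near. Qed.

Definition prim f : R -> R :=
  xget (cst 0) [set F | drv F f /\ F 0 = 0].

Lemma primP f : continuous f -> drv (prim f) f /\ prim f 0 = 0.
Proof.
move=> cf; have [F dF F0] := primitive_exists cf.
by rewrite /prim; case: xgetP => [G _ //|/(_ F)[]].
Qed.

(** On the half-line, [V] plus or minus [prim f - prim g] is nondecreasing and
    starts from [V 0]. *)
Lemma prim_comparison f g V v : continuous f -> continuous g -> drv V v ->
  0 <= V 0 -> (forall x, 0 <= x -> `|f x - g x| <= v x) ->
  forall x, 0 <= x -> `|prim f x - prim g x| <= V x.
Proof.
move=> /primP[df f0] /primP[dg g0] dV V0 fg x x0.
have h1 : V 0 - (prim f 0 - prim g 0) <= V x - (prim f x - prim g x).
  apply: (drv_ge0 (drvB dV (drvB df dg)) _ (lexx 0) x0) => t /fg.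
  by rewrite ler_norml => /andP[]; lra.
have h2 : V 0 + (prim f 0 - prim g 0) <= V x + (prim f x - prim g x).
  apply: (drv_ge0 (drvD dV (drvB df dg)) _ (lexx 0) x0) => t /fg.
  by rewrite ler_norml => /andP[]; lra.
by rewrite ler_norml; apply/andP; split; lra.
Qed.

Lemma prim_odd f : continuous f -> (forall x, f (- x) = f x) ->
  forall x, prim f (- x) = - prim f x.
Proof.
move=> /primP[df f0] ef x; apply/esym/eqP; rewrite eqr_oppLR; apply/eqP.
apply: (@drv_eq _ (prim f) (fun y => - prim f (- y)) f 0) => //.
  by apply: drv_ext (drvN (drv_opp_arg df)) _ => t /=; rewrite opprK ef.
by rewrite oppr0 f0 oppr0.
Qed.

Definition tail_spec f F :=
  drv F (fun x => - f x) /\ F x @[x --> +oo] --> 0.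

(** The integral of [f] over [[x, +oo[] as a function of [x], characterised as
    the primitive of [- f] that vanishes at infinity. *)
Definition tail f : R -> R := xget (cst 0) [set F | tail_spec f F].

Lemma tailP f F : tail_spec f F -> tail_spec f (tail f).
Proof. by move=> HF; rewrite /tail; case: xgetP => [G _ //|/(_ F)]. Qed.

Lemma tail_even f F : tail_spec f F -> (forall x, f (- x) = - f x) ->
  forall x, tail f (- x) = tail f x.
Proof.
move=> /tailP[df _] fo x.
apply/esym/(@drv_eq _ (tail f) (fun y => tail f (- y)) (fun y => - f y) 0) => //.
  by apply: drv_ext (drv_opp_arg df) _ => t /=; rewrite opprK fo.
by rewrite oppr0.
Qed.

End Primitives.

(** * The exponential weight *)

Section Weight.
Variable R : realType.

(** A smooth even function comparable to [expR (- `|x| / 2)].  Since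
    [`|wgt'| <= wgt / 2], multiples of [wgt] serve as barriers for every first
    order equation [M' = b M - q] with [b > 1 / 2].  Any rate strictly between 0
    and the rate 1 of the soliton would do in place of [1 / 2]. *)
Definition wgt (x : R) : R := (expR (x / 2) + expR (- (x / 2)))^-1.

Definition wgt' (x : R) : R :=
  - (expR (x / 2) - expR (- (x / 2))) / 2 * wgt x ^+ 2.

Lemma wgt_gt0 x : 0 < wgt x.
Proof. by rewrite invr_gt0 addr_gt0 ?expR_gt0. Qed.

Lemma wgt_even x : wgt (- x) = wgt x.
Proof. by rewrite /wgt mulNr opprK addrC. Qed.

Lemma drv_wgt : drv wgt wgt'.
Proof.
have dl : drv (fun x : R => x / 2) (fun _ => 2^-1).
  by apply: drv_ext; [exact: (drvM (@drv_id R) (drv_cst _))|move=> x /=; ring].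
have de := drvD (drv_expR dl) (drv_expR (drvN dl)).
apply: drv_ext; first apply: (drvV _ de).
  by move=> x; rewrite gt_eqF // addr_gt0 ?expR_gt0.
by move=> x; rewrite /wgt' /wgt /=; field; rewrite gt_eqF // addr_gt0 ?expR_gt0.
Qed.

Lemma wgt'_le x : `|wgt' x| <= wgt x / 2.
Proof.
have a0 := expR_gt0 (x / 2); have b0 := expR_gt0 (- (x / 2)).
have W0 := wgt_gt0 x; rewrite /wgt'.
have E : (expR (x / 2) + expR (- (x / 2))) * wgt x = 1.
  by rewrite divff // gt_eqF // addr_gt0.
have {2}-> : wgt x = (expR (x / 2) + expR (- (x / 2))) * wgt x ^+ 2.
  by rewrite expr2 mulrA E mul1r.
have W2 : 0 <= wgt x ^+ 2 by rewrite exprn_ge0 // ltW.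
rewrite normrM (ger0_norm W2) -[leRHS]mulrAC ler_wpM2r // normrM normrN.
rewrite ger0_norm ?invr_ge0 // ler_wpM2r ?invr_ge0 // ler_norml.
by apply/andP; split; lra.
Qed.

Lemma wgt_le_exp x : wgt x <= expR (- (x / 2)).
Proof.
rewrite expRN lef_pV2 ?posrE ?addr_gt0 ?expR_gt0 //.
by rewrite lerDl expR_ge0.
Qed.

Lemma wgt_le1 x : wgt x <= 1.
Proof.
wlog x0 : x / 0 <= x.
  by move=> H; case: (leP 0 x) => [/H //|/ltW x0]; rewrite -wgt_even H // oppr_ge0.
by apply: le_trans (wgt_le_exp x) _; rewrite expR_le1 oppr_le0 divr_ge0.
Qed.

Lemma exp_le_wgt x : 0 <= x -> expR (- (x / 2)) <= 2 * wgt x.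
Proof.
move=> x0; have a0 := expR_gt0 (x / 2).
rewrite expRN /wgt expRN; set a := expR (x / 2).
have a1 : 1 <= a by rewrite -expR0 ler_expR divr_ge0.
have b0 : 0 < a by rewrite expR_gt0.
rewrite ler_pdivlMr ?addr_gt0 ?invr_gt0 // mulrDr mulVf ?gt_eqF //.
have : a^-1 <= 1 by rewrite invf_le1.
have : 0 <= a^-1 by rewrite invr_ge0 ltW.
nra.
Qed.

Lemma cvg_exp_half : expR (- (x / 2)) @[x --> +oo] --> (0 : R).
Proof.
apply/cvgrPdist_lt => e e0.
have /cvgrPdist_lt/(_ e e0) := @cvgr_expR R => -[M [Mr HM]].
exists (2 * M); split; first exact: num_real.
by move=> x Mx; apply: HM; rewrite ltr_pdivlMr // mulrC.
Qed.

Lemma dominated_cvg0 (f g : R -> R) (a : R) : g x @[x --> +oo] --> 0 ->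
  (forall x, a <= x -> `|f x| <= g x) -> f x @[x --> +oo] --> 0.
Proof.
move=> g0 fg; apply/cvgrPdist_lt => e e0.
have /cvgrPdist_lt/(_ e e0) := g0 => ge.
near=> x; have : `|0 - g x| < e by near: x.
rewrite !sub0r !normrN; apply: le_lt_trans.
by apply: le_trans (ler_norm _); apply: fg; near: x; apply: nbhs_pinfty_ge; exact: num_real.
Unshelve. all: by end_near. Qed.

Lemma wgt_cvg0 c : (c * wgt x) @[x --> +oo] --> (0 : R).
Proof.
rewrite -(mulr0 c); apply: cvgMr.
apply: (dominated_cvg0 (a := 0) cvg_exp_half) => x _.
by rewrite gtr0_norm ?wgt_gt0 // wgt_le_exp.
Qed.

Definition dom (f : R -> R) (c : R) := forall x, `|f x| <= c * wgt x.

Lemma dom_le f c d : c <= d -> dom f c -> dom f d.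
Proof.
by move=> cd fc x; apply: le_trans (fc x) _; rewrite ler_wpM2r // ltW ?wgt_gt0.
Qed.

Lemma domD f g c d : dom f c -> dom g d -> dom (fun x => f x + g x) (c + d).
Proof.
by move=> fc gd x; rewrite mulrDl (le_trans (ler_normD _ _)) // lerD.
Qed.

Lemma domN f c : dom f c -> dom (fun x => - f x) c.
Proof. by move=> fc x; rewrite normrN. Qed.

Lemma domB f g c d : dom f c -> dom g d -> dom (fun x => f x - g x) (c + d).
Proof. by move=> fc gd; apply: domD => //; exact: domN. Qed.

Lemma domM f g c k : 0 <= k -> (forall x, `|f x| <= k) -> dom g c ->
  dom (fun x => f x * g x) (k * c).
Proof. by move=> k0 fk gc x; rewrite normrM -mulrA ler_pM. Qed.

Lemma domZ k f c : dom f c -> dom (fun x => k * f x) (`|k| * c).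
Proof. by move=> fc; apply: (@domM (fun _ => k)). Qed.

Lemma dom_ge0 f c : dom f c -> 0 <= c.
Proof.
move=> /(_ 0) fc; rewrite -(pmulr_lge0 _ (wgt_gt0 0)).
exact: le_trans (normr_ge0 _) fc.
Qed.

Lemma dom_bounded f c x : dom f c -> `|f x| <= c.
Proof.
move=> fc; apply: le_trans (fc x) _; rewrite -[leRHS]mulr1.
by rewrite ler_wpM2l ?wgt_le1 // (dom_ge0 fc).
Qed.

Lemma dom_opp_arg f c : dom f c -> dom (fun x => f (- x)) c.
Proof. by move=> fc x; rewrite -wgt_even. Qed.

Lemma dom_sym f c : (forall x, `|f (- x)| = `|f x|) ->
  (forall x, 0 <= x -> `|f x| <= c * wgt x) -> dom f c.
Proof.
move=> sf fc x; case: (leP 0 x) => [/fc //|/ltW x0].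
by rewrite -sf -wgt_even fc // oppr_ge0.
Qed.

End Weight.

(** * Fixed points in weighted uniform distance *)

Section WeightedFixedPoint.
Variables (R : realType) (T : Type) (w : T -> R).
Hypothesis w_ge0 : forall x, 0 <= w x.

Lemma halfpow_small (c e : R) : 0 < e -> exists n, c * 2^-1 ^+ n < e.
Proof.
move=> e0; have : (c * 2^-1 ^+ n) @[n --> \oo] --> (0 : R).
  rewrite -(mulr0 c); apply: cvgMr; apply: cvg_expr.
  by rewrite ger0_norm ?invr_ge0 // invf_lt1 // ltr1n.
move=> /cvgrPdist_lt/(_ e e0)[N _ HN]; exists N.
have := HN N (leqnn N); rewrite /= sub0r normrN; apply: le_lt_trans.
exact: ler_norm.
Qed.

(** The contraction principle for the distance
    [inf {m | forall x, `|u x - v x| <= m * w x}].  With [c = 2 delta w], the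
    intervals of centre [u_n x] and radius [c / 2^n] around the iterates are
    nested, so that the limit is a pointwise supremum. *)
Lemma weighted_fixed_point (X : (T -> R) -> Prop) (Phi : (T -> R) -> T -> R)
    (delta : R) :
  X (fun _ => 0) -> 0 <= delta ->
  (forall u, (forall e, 0 < e ->
     exists2 v, X v & forall x, `|u x - v x| <= e * w x) -> X u) ->
  (forall u, X u -> (forall x, `|u x| <= delta * w x) ->
     X (Phi u) /\ forall x, `|Phi u x| <= delta * w x) ->
  (forall u v m, X u -> X v -> (forall x, `|u x| <= delta * w x) ->
     (forall x, `|v x| <= delta * w x) ->
     (forall x, `|u x - v x| <= m * w x) ->
     forall x, `|Phi u x - Phi v x| <= m / 2 * w x) ->
  exists u, [/\ X u, forall x, `|u x| <= delta * w x & forall x, Phi u x = u x].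
Proof.
move=> X0 d0 Xclosed Xstable contr.
pose u n := iter n Phi (fun _ => 0).
have uX n : X (u n) /\ forall x, `|u n x| <= delta * w x.
  elim: n => [|n [IH1 IH2]]; last exact: Xstable.
  by split=> // x; rewrite normr0 mulr_ge0.
have step n x : `|u n.+1 x - u n x| <= delta * 2^-1 ^+ n * w x.
  elim: n x => [|n IH] x.
    by rewrite subr0 expr0 mulr1; have [_] := uX 1%N.
  have [X1 b1] := uX n.+1; have [X2 b2] := uX n.
  by have := contr _ _ _ X1 X2 b1 b2 IH x; rewrite exprSr mulrA.
pose r n x := 2 * delta * w x * 2^-1 ^+ n.
have nest n x : u n x - r n x <= u n.+1 x - r n.+1 x /\
                u n.+1 x + r n.+1 x <= u n x + r n x.
  have := step n x; rewrite ler_norml /r exprS => /andP[].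
  by set t := 2^-1 ^+ n; split; lra.
have r0 n x : 0 <= r n x by rewrite /r !mulr_ge0 // exprn_ge0 // invr_ge0.
have lo n k x : u n x - r n x <= u (n + k)%N x - r (n + k)%N x.
  elim: k => [|k IH]; first by rewrite addn0.
  by rewrite addnS; apply: le_trans IH _; have [] := nest (n + k)%N x.
have hi n k x : u (n + k)%N x + r (n + k)%N x <= u n x + r n x.
  elim: k => [|k IH]; first by rewrite addn0.
  by rewrite addnS; apply: le_trans IH; have [] := nest (n + k)%N x.
have lohi n m x : u n x - r n x <= u m x + r m x.
  apply: le_trans (lo n m x) _; apply: le_trans (hi m n x).
  by rewrite addnC; have := r0 (m + n)%N x; lra.
pose l x := sup [set u n x - r n x | n in [set: nat]].
have ul n x : `|l x - u n x| <= r n x.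
  rewrite ler_norml; apply/andP; split.
    rewrite lerBrDr addrC; apply: ub_le_sup; last by exists n.
    by exists (u 0%N x + r 0%N x) => _ [m _ <-].
  rewrite lerBlDl; apply: ge_sup; first by exists (u 0%N x - r 0%N x), 0%N.
  by move=> _ [m _ <-].
have small (x : T) e : 0 < e -> exists n, r n x < e by exact: halfpow_small.
have le_of_r (x : T) (s z : R) : (forall n, s <= z + r n x) -> s <= z.
  move=> H; rewrite leNgt; apply/negP => zs.
  have [|n rn] := small x (s - z); first by rewrite subr_gt0.
  by have := H n; lra.
have lX : X l.
  apply: Xclosed => e e0; have [n en] := halfpow_small (2 * delta) e0.
  exists (u n); first by have [] := uX n.
  move=> x; apply: le_trans (ul n x) _.
  by rewrite /r mulrAC ler_wpM2r // ltW.
have ld x : `|l x| <= delta * w x.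
  apply: (le_of_r x) => n; have := ler_normD (l x - u n x) (u n x).
  by rewrite subrK; have := ul n x; have [_ /(_ x)] := uX n; lra.
exists l; split=> // x.
apply/eqP; rewrite -subr_eq0 -normr_le0; apply: (le_of_r x) => n.
have [Xn bn] := uX n.
have H y : `|l y - u n y| <= 2 * delta * 2^-1 ^+ n * w y by rewrite mulrAC; exact: ul.
have h1 := contr _ _ _ lX Xn ld bn H x; have h2 := ul n.+1 x.
have := ler_normD (Phi l x - u n.+1 x) (u n.+1 x - l x).
rewrite subrKA add0r => h3; apply: le_trans h3 _.
rewrite -(normrN (u n.+1 x - l x)) opprB; move: h1 h2; rewrite /r exprS.
by set t := 2^-1 ^+ n; rewrite [u n.+1]iterS => h1 h2; lra.
Qed.

End WeightedFixedPoint.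

(** * Inverting [1 - b^-2 D^2] on even functions *)

Section Resolvent.
Variables (R : realType) (b : R).
Hypothesis b_gt : 2^-1 < b.
Local Notation wgt := (@wgt R).
Local Notation d := (b - 2^-1).
Implicit Types q : R -> R.

Let kern q : R -> R := fun x => expR (- (b * x)) * q x.

Let drv_expn : drv (fun x : R => expR (- (b * x))) (fun x => - b * expR (- (b * x))).
Proof.
apply: drv_ext; first exact: (drv_expR (drvN (drvZ b (@drv_id R)))).
by move=> x /=; rewrite mulr1.
Qed.

Let drv_exp : drv (fun x : R => expR (b * x)) (fun x => b * expR (b * x)).
Proof.
apply: drv_ext; first exact: (drv_expR (drvZ b (@drv_id R))).
by move=> x /=; rewrite mulr1.
Qed.

(** A decreasing barrier: - bar' c dominates kern q as soon as dom q c, because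
   wgt' - b wgt <= - (b - 1/2) wgt. *)
Let bar (c : R) x := c / d * (expR (- (b * x)) * wgt x).
Let bar' (c : R) x := c / d * (expR (- (b * x)) * (wgt' x - b * wgt x)).

Let drv_bar c : drv (bar c) (bar' c).
Proof.
apply: drv_ext; first exact: (drvZ (c / d) (drvM drv_expn (@drv_wgt R))).
by move=> x /=; rewrite /bar'; ring.
Qed.

Let d_gt0 : 0 < d. Proof. by rewrite subr_gt0. Qed.

Let bar_cvg0 c : bar c x @[x --> +oo] --> 0.
Proof.
apply: (dominated_cvg0 (a := 0) (@wgt_cvg0 R `|c / d|)) => x x0.
rewrite normrM ler_wpM2l // normrM (gtr0_norm (wgt_gt0 x)).
rewrite ler_piMl ?(ltW (wgt_gt0 x)) // ger0_norm ?expR_ge0 // expR_le1.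
by rewrite oppr_le0 mulr_ge0 //; have := d_gt0; lra.
Qed.

Let bar_le c q : dom q c -> forall x, `|kern q x| <= - bar' c x.
Proof.
move=> qc x; have e0 := expR_gt0 (- (b * x)); have c0 := dom_ge0 qc.
rewrite /kern normrM gtr0_norm // (_ : - bar' c x = expR (- (b * x)) *
  (c / d * (b * wgt x - wgt' x))); last by rewrite /bar'; ring.
rewrite ler_pM2l //; apply: le_trans (qc x) _; rewrite -mulrA ler_wpM2l //.
rewrite mulrC ler_pdivlMr //.
by have := wgt'_le x; rewrite ler_norml => /andP[]; have := wgt_gt0 x; nra.
Qed.

Let kern_tail q c : continuous q -> dom q c -> exists F, tail_spec (kern q) F.
Proof.
move=> cq qc; have [||F dF F0] := @tail_exists R (kern q) _ _ 0 _ (drv_bar c) (bar_cvg0 c).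
- by apply: contM => //; exact: drv_continuous drv_expn.
- by move=> x _; exact: bar_le.
by exists F.
Qed.

Let kern_tail_le q c F : tail_spec (kern q) F -> dom q c ->
  forall x, `|F x| <= bar c x.
Proof.
move=> [dF F0] qc x.
apply: (tail_comparison dF (drv_bar c) F0 (bar_cvg0 c) _ (lexx x)) => y _.
by rewrite normrN; exact: bar_le.
Qed.

(** The solution of [M' = b M - q] bounded at infinity, that is
    [expR (b x)] times the integral of [expR (- b y) q y] over [[x, +oo[]. *)
Definition back q : R -> R := fun x => expR (b * x) * tail (kern q) x.

Lemma drv_back q c : continuous q -> dom q c ->
  drv (back q) (fun x => b * back q x - q x).
Proof.
move=> cq qc; have [F /tailP[dF _]] := kern_tail cq qc.
apply: drv_ext; first exact: (drvM drv_exp dF).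
move=> x /=; rewrite /kern /back -[q x in RHS]mul1r -(expRxMexpNx_1 (b * x)).
by ring.
Qed.

Let back_le q c F : tail_spec (kern q) F -> dom q c ->
  dom (fun x => expR (b * x) * F x) (c / d).
Proof.
move=> HF qc x; have := kern_tail_le HF qc x.
rewrite normrM (gtr0_norm (expR_gt0 (b * x))) -(ler_pM2l (expR_gt0 (b * x))) /bar.
rewrite mulrCA (mulrA (expR (b * x))) expRxMexpNx_1 mul1r => h; exact: h.
Qed.

Lemma dom_back q c : continuous q -> dom q c -> dom (back q) (c / d).
Proof.
by move=> cq qc; have [F /tailP HF] := kern_tail cq qc; exact: back_le HF qc.
Qed.

Lemma back_dist q1 q2 c1 c2 c : continuous q1 -> continuous q2 ->
  dom q1 c1 -> dom q2 c2 -> dom (fun x => q1 x - q2 x) c ->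
  dom (fun x => back q1 x - back q2 x) (c / d).
Proof.
move=> cq1 cq2 d1 d2 d12.
have [F1 /tailP [H1 L1]] := kern_tail cq1 d1; have [F2 /tailP [H2 L2]] := kern_tail cq2 d2.
have H : tail_spec (kern (fun x => q1 x - q2 x))
    (fun x => tail (kern q1) x - tail (kern q2) x).
  split; first by apply: drv_ext; [exact: (drvB H1 H2)|move=> x /=; rewrite /kern; ring].
  by rewrite -[0](subrr 0); exact: cvgB.
by move=> x; have := back_le H d12 x; rewrite mulrBr.
Qed.

(** For odd [q = f'], the function [f + corr q] solves
    [g - b^-2 g'' = f]: the correction is of the size of [f' / b], which
    expresses that [(1 - b^-2 D^2)^-1] tends to the identity on functions with
    a bounded derivative as [b] tends to infinity. *)
Definition corr q : R -> R := fun x => (back q x + back q (- x)) / 2.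

Lemma corr_even q x : corr q (- x) = corr q x.
Proof. by rewrite /corr opprK addrC. Qed.

Let dom_avg (f : R -> R) c : dom f c -> dom (fun x => (f x + f (- x)) / 2) c.
Proof.
move=> fc x; have := fc x; have := fc (- x); rewrite wgt_even => h1 h2.
rewrite normrM (ger0_norm (_ : 0 <= 2^-1 :> R)) ?invr_ge0 //.
by have := ler_normD (f x) (f (- x)); lra.
Qed.

Lemma dom_corr q c : continuous q -> dom q c -> dom (corr q) (c / d).
Proof. by move=> cq qc; apply: dom_avg; exact: dom_back. Qed.

Lemma corr_dist q1 q2 c1 c2 c : continuous q1 -> continuous q2 ->
  dom q1 c1 -> dom q2 c2 -> dom (fun x => q1 x - q2 x) c ->
  dom (fun x => corr q1 x - corr q2 x) (c / d).
Proof.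
move=> cq1 cq2 d1 d2 d12 x.
have := dom_avg (back_dist cq1 cq2 d1 d2 d12) x; congr (`|_| <= _).
by rewrite /corr; lra.
Qed.

(** The derivative of [f + corr f'] for even [f]. *)
Definition flux q : R -> R := fun x => b / 2 * (back q x - back q (- x)).

Lemma dom_flux q c : continuous q -> dom q c -> dom (flux q) (b * (c / d)).
Proof.
move=> cq qc; have H := dom_back cq qc.
have b0 : 0 <= b by have := d_gt0; lra.
apply: dom_le; last exact: (domZ (b / 2) (domB H (dom_opp_arg H))).
by rewrite ger0_norm ?divr_ge0 //; lra.
Qed.

Lemma resolvent f q c : drv f q -> continuous q -> dom q c ->
  (forall x, q (- x) = - q x) ->
  drv (fun x => f x + corr q x) (flux q) /\
  drv (flux q) (fun x => b ^+ 2 * corr q x).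
Proof.
move=> df cq qc qodd; have dM := drv_back cq qc; have dM' := drv_opp_arg dM.
split.
  apply: drv_ext; first exact: (drvD df (drvM (drvD dM dM') (drv_cst 2^-1))).
  by move=> x /=; rewrite /flux qodd; field.
apply: drv_ext; first exact: (drvZ (b / 2) (drvB dM dM')).
by move=> x /=; rewrite /corr qodd; field.
Qed.

Lemma corr_continuous q c : continuous q -> dom q c -> continuous (corr q).
Proof.
move=> cq qc; have dM := drv_back cq qc.
exact: (drv_continuous (drvM (drvD dM (drv_opp_arg dM)) (drv_cst 2^-1))).
Qed.

End Resolvent.

(** * Green operators of even potentials *)

Section Green.
Variable R : realType.

Lemma drv_unique (f g h : R -> R) : drv f g -> drv f h -> forall x, g x = h x.
Proof.
by move=> dg dh x; have [_ <-] := dg x; have [_ <-] := dh x.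
Qed.

Lemma drv_even_odd (f f' : R -> R) : drv f f' -> (forall x, f (- x) = f x) ->
  forall x, f' (- x) = - f' x.
Proof.
move=> df ef x; have := drv_opp_arg df.
rewrite (_ : (fun y => f (- y)) = f); last by apply/funext => y; rewrite ef.
by move/(drv_unique df)/(_ x) => ->; rewrite opprK.
Qed.

(** [u1] and [u2] are the odd decaying and the even growing solution of
    [u'' = V u], and [- om] is their Wronskian. *)
Variables (V u1 u1' u2 u2' : R -> R) (om B : R).
Hypotheses (du1 : drv u1 u1') (du1' : drv u1' (fun x => V x * u1 x)).
Hypotheses (du2 : drv u2 u2') (du2' : drv u2' (fun x => V x * u2 x)).
Hypothesis wronskian : forall x, u1' x * u2 x - u1 x * u2' x = - om.
Hypothesis om_gt0 : 0 < om.
Hypotheses (u1_odd : forall x, u1 (- x) = - u1 x)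
  (u2_even : forall x, u2 (- x) = u2 x).
Hypotheses (u1_le : forall x, 0 <= x -> `|u1 x| <= B * expR (- x))
  (u1'_le : forall x, 0 <= x -> `|u1' x| <= B * expR (- x))
  (u2_le : forall x, 0 <= x -> `|u2 x| <= B * expR x)
  (u2'_le : forall x, 0 <= x -> `|u2' x| <= B * expR x).

(** Variation of constants: for even [r], the solution of [- g'' + V g = r] that
    is even and decays. *)
Definition green (r : R -> R) : R -> R := fun x =>
  om^-1 * (u1 x * prim (fun y => u2 y * r y) x +
           u2 x * tail (fun y => u1 y * r y) x).

Definition green' (r : R -> R) : R -> R := fun x =>
  om^-1 * (u1' x * prim (fun y => u2 y * r y) x +
           u2' x * tail (fun y => u1 y * r y) x).

Let B_ge0 : 0 <= B.
Proof.
have := u1_le (lexx 0); rewrite oppr0 expR0 mulr1; exact: le_trans.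
Qed.

(** Barriers for the two integrals in the Green formula; multiplied by the
   opposite exponential bound of u1 and u2, both become multiples of wgt. *)
Let rise c x : R := 2 * B * c * (expR x * wgt x).
Let rise' c x : R := 2 * B * c * (expR x * (wgt x + wgt' x)).
Let fall c x : R := 2 * B * c * (expR (- x) * wgt x).
Let fall' c x : R := 2 * B * c * (expR (- x) * (wgt' x - wgt x)).

Let drv_rise c : drv (rise c) (rise' c).
Proof.
apply: drv_ext.
  exact: (drvZ (2 * B * c) (drvM (drv_expR (@drv_id R)) (@drv_wgt R))).
by move=> x /=; rewrite /rise'; ring.
Qed.

Let drv_fall c : drv (fall c) (fall' c).
Proof.
apply: drv_ext.
  exact: (drvZ (2 * B * c) (drvM (drv_expR (drvN (@drv_id R))) (@drv_wgt R))).
by move=> x /=; rewrite /fall'; ring.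
Qed.

Let fall_cvg0 c : fall c x @[x --> +oo] --> 0.
Proof.
apply: (dominated_cvg0 (a := 0) (@wgt_cvg0 R `|2 * B * c|)) => x x0.
rewrite normrM ler_wpM2l // normrM (gtr0_norm (wgt_gt0 x)).
rewrite ler_piMl ?(ltW (wgt_gt0 x)) // ger0_norm ?expR_ge0 // expR_le1.
by rewrite oppr_le0.
Qed.

Let le_rise' c r : 0 <= c -> dom r c -> forall x, 0 <= x ->
  `|u2 x * r x| <= rise' c x.
Proof.
move=> c0 rc x x0; rewrite normrM.
apply: (@le_trans _ _ (B * expR x * (c * wgt x))); first by rewrite ler_pM // u2_le.
rewrite (_ : rise' c x = B * expR x * (c * (2 * (wgt x + wgt' x)))); last first.
  by rewrite /rise'; ring.
rewrite ler_wpM2l ?mulr_ge0 ?expR_ge0 // ler_wpM2l //.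
by have := wgt'_le x; rewrite ler_norml => /andP[]; lra.
Qed.

Let le_fall' c r : 0 <= c -> dom r c -> forall x, 0 <= x ->
  `|u1 x * r x| <= - fall' c x.
Proof.
move=> c0 rc x x0; rewrite normrM.
apply: (@le_trans _ _ (B * expR (- x) * (c * wgt x))).
  by rewrite ler_pM // u1_le.
rewrite (_ : - fall' c x = B * expR (- x) * (c * (2 * (wgt x - wgt' x)))).
  rewrite ler_wpM2l ?mulr_ge0 ?expR_ge0 // ler_wpM2l //.
  by have := wgt'_le x; rewrite ler_norml => /andP[]; lra.
by rewrite /fall'; ring.
Qed.

Let cu1 : continuous u1 := drv_continuous du1.
Let cu2 : continuous u2 := drv_continuous du2.

Let tail_u1 c r : continuous r -> dom r c ->
  tail_spec (fun y => u1 y * r y) (tail (fun y => u1 y * r y)).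
Proof.
move=> cr rc; have c0 := dom_ge0 rc.
have [||F dF F0] := @tail_exists R (fun y => u1 y * r y) _ _ 0 _ (drv_fall c) (fall_cvg0 c).
- exact: contM.
- exact: le_fall'.
by apply: (@tailP _ _ F).
Qed.

Lemma drv_green c r : continuous r -> dom r c -> drv (green r) (green' r).
Proof.
move=> cr rc; have [dT _] := tail_u1 cr rc.
have [dA _] := primP (contM cu2 cr).
apply: drv_ext; first exact: (drvZ om^-1 (drvD (drvM du1 dA) (drvM du2 dT))).
by move=> x /=; rewrite /green'; ring.
Qed.

Lemma drv_green' c r : continuous r -> dom r c ->
  drv (green' r) (fun x => V x * green r x - r x).
Proof.
move=> cr rc; have [dT _] := tail_u1 cr rc.
have [dA _] := primP (contM cu2 cr).
apply: drv_ext; first exact: (drvZ om^-1 (drvD (drvM du1' dA) (drvM du2' dT))).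
move=> x /=; have w := wronskian x.
have E : r x = om^-1 * (- (u1' x * u2 x - u1 x * u2' x)) * r x.
  by rewrite w opprK mulVf ?mul1r // gt_eqF.
by rewrite [r x in RHS]E /green; ring.
Qed.

Lemma green_even c r : continuous r -> dom r c -> (forall x, r (- x) = r x) ->
  forall x, green r (- x) = green r x.
Proof.
move=> cr rc re x; rewrite /green u1_odd u2_even prim_odd.
- rewrite (tail_even (tail_u1 cr rc)) ?mulrNN // => y.
  by rewrite u1_odd re mulNr.
- exact: contM.
- by move=> y; rewrite u2_even re.
Qed.

Definition gain : R := 4 * B ^+ 2 / om.

Section Distance.
Variables (r1 r2 : R -> R) (c1 c2 c : R).
Hypotheses (cr1 : continuous r1) (cr2 : continuous r2).
Hypotheses (r1c : dom r1 c1) (r2c : dom r2 c2).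
Hypothesis r12 : dom (fun x => r1 x - r2 x) c.

Let c_ge0 : 0 <= c := dom_ge0 r12.

Let prim_dist x : 0 <= x ->
  `|prim (fun y => u2 y * r1 y) x - prim (fun y => u2 y * r2 y) x| <= rise c x.
Proof.
apply: (prim_comparison (contM cu2 cr1) (contM cu2 cr2) (drv_rise c)).
  by rewrite /rise !mulr_ge0 ?expR_ge0 // ltW ?wgt_gt0.
by move=> y y0; rewrite -mulrBr; exact: (le_rise' c_ge0 r12).
Qed.

Let tail_dist x : 0 <= x ->
  `|tail (fun y => u1 y * r1 y) x - tail (fun y => u1 y * r2 y) x| <= fall c x.
Proof.
move=> x0; have [d1 l1] := tail_u1 cr1 r1c; have [d2 l2] := tail_u1 cr2 r2c.
apply: (tail_comparison (drvB d1 d2) (drv_fall c) _ (fall_cvg0 c) _ x0).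
  by rewrite -[0](subrr 0); exact: cvgB.
move=> y y0; rewrite -opprD normrN -mulrBr; exact: (le_fall' c_ge0 r12).
Qed.

Let half_dist (v1 v2 : R -> R) x :
  (forall x, 0 <= x -> `|v1 x| <= B * expR (- x)) ->
  (forall x, 0 <= x -> `|v2 x| <= B * expR x) -> 0 <= x ->
  `|om^-1 * (v1 x * prim (fun y => u2 y * r1 y) x +
             v2 x * tail (fun y => u1 y * r1 y) x) -
    om^-1 * (v1 x * prim (fun y => u2 y * r2 y) x +
             v2 x * tail (fun y => u1 y * r2 y) x)| <= gain * c * wgt x.
Proof.
move=> h1 h2 x0; rewrite -mulrBr normrM gtr0_norm ?invr_gt0 //.
rewrite (_ : gain * c * wgt x =
  om^-1 * (B * expR (- x) * rise c x + B * expR x * fall c x)); last first.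
  rewrite /rise /fall /gain; have := expRxMexpNx_1 x.
  set e := expR x; set e' := expR (- x) => ee.
  rewrite (_ : _ + _ = e * e' * (4 * B ^+ 2 * c * wgt x)); last by ring.
  by rewrite ee; ring.
rewrite ler_wpM2l ?invr_ge0 ?(ltW om_gt0) // opprD addrACA -!mulrBr.
apply: le_trans (ler_normD _ _) _; rewrite !normrM.
by rewrite lerD // ler_pM // ?h1 ?h2 ?prim_dist ?tail_dist.
Qed.

Hypotheses (r1_even : forall x, r1 (- x) = r1 x)
  (r2_even : forall x, r2 (- x) = r2 x).

Lemma green_dist : dom (fun x => green r1 x - green r2 x) (gain * c).
Proof.
apply: dom_sym => x.
  by rewrite (green_even cr1 r1c) // (green_even cr2 r2c).
exact: half_dist.
Qed.

Lemma green'_dist : dom (fun x => green' r1 x - green' r2 x) (gain * c).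
Proof.
apply: dom_sym => x; last exact: half_dist.
rewrite (drv_even_odd (drv_green cr1 r1c) (green_even cr1 r1c r1_even)).
rewrite (drv_even_odd (drv_green cr2 r2c) (green_even cr2 r2c r2_even)).
by rewrite -opprD normrN.
Qed.

End Distance.

Let prim0 x : prim (fun y => u2 y * 0) x = 0.
Proof.
have [dA A0] : drv (prim (fun y => u2 y * 0)) (fun y => u2 y * 0) /\ _ :=
  primP (contM cu2 (drv_continuous (drv_cst 0))).
apply: (@drv_eq _ _ (fun=> 0) _ 0 dA) => //.
by apply: drv_ext (drv_cst 0) _ => y; rewrite mulr0.
Qed.

Let dom0 : dom (fun _ : R => 0) 0.
Proof. by move=> x; rewrite normr0 mul0r. Qed.

Let c0 : continuous (fun _ : R => 0 : R) := drv_continuous (drv_cst 0).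

Let tail0 x : tail (fun y => u1 y * 0) x = 0.
Proof.
have [dT T0] := tail_u1 c0 dom0.
apply/eqP; rewrite -normr_le0.
apply: (tail_comparison dT (drv_cst 0) T0 (cvg_cst _) _ (lexx x)) => y _.
by rewrite mulr0 oppr0 normr0.
Qed.

Let green0 x : green (fun=> 0) x = 0.
Proof. by rewrite /green prim0 tail0 !mulr0 addr0 mulr0. Qed.

Let green'0 x : green' (fun=> 0) x = 0.
Proof. by rewrite /green' prim0 tail0 !mulr0 addr0 mulr0. Qed.

Lemma dom_green c r : continuous r -> dom r c -> (forall x, r (- x) = r x) ->
  dom (green r) (gain * c) /\ dom (green' r) (gain * c).
Proof.
move=> cr rc re; have d0 : dom (fun x => r x - 0) c by move=> x; rewrite subr0.
split=> x.
  have := green_dist cr c0 rc dom0 d0 re (fun=> erefl) x.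
  by rewrite green0 subr0.
have := green'_dist cr c0 rc dom0 d0 re (fun=> erefl) x.
by rewrite green'0 subr0.
Qed.

End Green.

(** * The soliton and its linearised equation *)

Section SolitonProfile.
Variables (R : realType) (p : nat).
Hypothesis p_gt0 : (0 < p)%N.
Local Notation P := (p%:R : R).

Let P_gt0 : 0 < P. Proof. by rewrite ltr0n. Qed.
Let P_ge1 : 1 <= P. Proof. by rewrite ler1n. Qed.

Let ep (x : R) := expR (P / 2 * x).
Let en (x : R) := expR (- (P / 2 * x)).

Let ep_gt0 x : 0 < ep x. Proof. exact: expR_gt0. Qed.
Let en_gt0 x : 0 < en x. Proof. exact: expR_gt0. Qed.
Let epn x : ep x * en x = 1. Proof. exact: expRxMexpNx_1. Qed.
Let s_gt0 x : 0 < ep x + en x. Proof. by rewrite addr_gt0. Qed.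
Let s_neq0 x : ep x + en x != 0. Proof. by rewrite gt_eqF. Qed.

Let drv_ep : drv ep (fun x => P / 2 * ep x).
Proof.
apply: drv_ext; first exact: (drv_expR (drvZ (P / 2) (@drv_id R))).
by move=> x /=; rewrite mulr1.
Qed.

Let drv_en : drv en (fun x => - (P / 2) * en x).
Proof.
apply: drv_ext; first exact: (drv_expR (drvN (drvZ (P / 2) (@drv_id R)))).
by move=> x /=; rewrite mulr1.
Qed.

Definition tnh (x : R) : R := (ep x - en x) / (ep x + en x).

Definition tnh' (x : R) : R := P / 2 * (1 - tnh x ^+ 2).

Lemma drv_tnh : drv tnh tnh'.
Proof.
apply: drv_ext; first exact: (drvM (drvB drv_ep drv_en) (drvV s_neq0 (drvD drv_ep drv_en))).
by move=> x /=; rewrite /tnh' /tnh; field.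
Qed.

Lemma tnh_odd x : tnh (- x) = - tnh x.
Proof.
have -> : tnh (- x) = (en x - ep x) / (en x + ep x).
  by rewrite /tnh /ep /en mulrN opprK.
by rewrite /tnh; field; rewrite s_neq0.
Qed.

Lemma tnh_le1 x : `|tnh x| <= 1.
Proof.
rewrite /tnh normrM normfV (gtr0_norm (s_gt0 x)) ler_pdivrMr ?mul1r // ler_norml.
by apply/andP; have := ep_gt0 x; have := en_gt0 x; split; lra.
Qed.

Lemma tnh2_le1 x : tnh x ^+ 2 <= 1.
Proof. by rewrite -real_normK ?num_real // expr_le1 // tnh_le1. Qed.

Definition profile (x : R) : R := sech (P / 2 * x) `^ (2 / P).

Let sech_gt0 (y : R) : 0 < sech y.
Proof. by rewrite divr_gt0 // addr_gt0 ?expR_gt0. Qed.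

Lemma profile_gt0 x : 0 < profile x.
Proof. exact: powR_gt0. Qed.

Lemma profile_even x : profile (- x) = profile x.
Proof. by rewrite /profile /sech mulrN opprK addrC. Qed.

Lemma profile0 : profile 0 = 1.
Proof.
by rewrite /profile /sech mulr0 oppr0 expR0 (_ : 2 / (1 + 1) = 1) ?powR1 //; field.
Qed.

Lemma drv_profile : drv profile (fun x => - tnh x * profile x).
Proof.
have ds : drv (fun x => sech (P / 2 * x)) (fun x => - (P / 2) * tnh x * sech (P / 2 * x)).
  apply: drv_ext; first exact: (drvZ 2 (drvV s_neq0 (drvD drv_ep drv_en))).
  move=> y /=; rewrite /tnh /sech -/(ep y) -/(en y).
  by field.
move=> x; have H := is_derive1_powR (2 / P) (sech_gt0 (P / 2 * x)).
have := @is_derive1_comp R (fun z => z `^ (2 / P)) (fun x => sech (P / 2 * x)) x _ _ H (ds x).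
move/is_derive_eq; apply.
have <- : sech (P / 2 * x) * sech (P / 2 * x) `^ (2 / P - 1) = profile x.
  by apply: mulr_powRB1; [exact: ltW|rewrite divr_gt0].
by field; rewrite gt_eqF ?P_gt0.
Qed.

(** [profile x ^+ p] is the square of the hyperbolic secant of [p x / 2]. *)
Lemma profile_pow x : profile x ^+ p = 1 - tnh x ^+ 2.
Proof.
rewrite /profile -powR_mulrn ?powR_ge0 // -powRrM divfK ?gt_eqF // powR_mulrn ?ltW //.
rewrite /sech /tnh -/(ep x) -/(en x).
have := epn x; set a := ep x; set c := en x => ac.
have s0 : a + c != 0 by exact: s_neq0.
apply: (mulIf (expf_neq0 2 s0)); rewrite expr_div_n mulfVK ?expf_neq0 //.
rewrite expr_div_n mulrBl mulfVK ?expf_neq0 //.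
rewrite mul1r (_ : (a + c) ^+ 2 - (a - c) ^+ 2 = 4 * (a * c)); last by ring.
by rewrite ac; ring.
Qed.

Lemma drv_profileV : drv (fun x => (profile x)^-1) (fun x => tnh x / profile x).
Proof.
have profile_neq0 x : profile x != 0 by rewrite gt_eqF ?profile_gt0.
apply: drv_ext; first exact: (drvV profile_neq0 drv_profile).
by move=> x /=; field.
Qed.

(** The function [expR (- x) / profile x] is nonincreasing and equals 1 at 0. *)
Lemma profileV_le x : 0 <= x -> (profile x)^-1 <= expR x.
Proof.
move=> x0.
have dn : drv (fun y : R => expR (- y)) (fun y => - expR (- y)).
  apply: drv_ext; first exact: (drv_expR (drvN (@drv_id R))).
  by move=> y /=; rewrite mulN1r.
have H := drvN (drvM dn drv_profileV).
have := drv_ge0 (a := 0) H _ (lexx 0) x0.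
rewrite oppr0 expR0 profile0 invr1 mulr1 lerN2 => H1.
have : expR (- x) * (profile x)^-1 <= 1.
  apply: H1 => y y0 /=.
  have -> : - (- expR (- y) * (profile y)^-1 + expR (- y) * (tnh y / profile y)) =
      (1 - tnh y) * (expR (- y) / profile y) by ring.
  apply: mulr_ge0; last by rewrite divr_ge0 ?expR_ge0 ?(ltW (profile_gt0 y)).
  by rewrite subr_ge0; exact: le_trans (ler_norm _) (tnh_le1 y).
by rewrite expRN mulrC ler_pdivrMr ?expR_gt0 // mul1r.
Qed.

Lemma profile_le x : 0 <= x -> profile x <= 4 * expR (- x).
Proof.
move=> x0; have sle : sech (P / 2 * x) <= 2 * expR (- (P / 2 * x)).
  rewrite /sech ler_wpM2l // expRN lef_pV2 ?posrE ?addr_gt0 ?invr_gt0 ?expR_gt0 //.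
  by rewrite lerDl invr_ge0 expR_ge0.
have q0 : 0 <= 2 / P by rewrite divr_ge0 // ltW.
apply: (@le_trans _ _ ((2 * expR (- (P / 2 * x))) `^ (2 / P))).
  by apply: ge0_ler_powR => //; rewrite nnegrE ?(ltW (sech_gt0 _)) // mulr_ge0 ?expR_ge0.
rewrite powRM ?expR_ge0 // -expRM (_ : - _ * _ = - x); last by field; rewrite gt_eqF.
rewrite ler_wpM2r ?expR_ge0 // (_ : 4 = 2 `^ 2); last first.
  by rewrite -[X in _ `^ X]/(2%:R) powR_mulrn //; ring.
by apply: ler_powR; rewrite ?ler1n // ler_pdivrMr //; have := P_ge1; lra.
Qed.

Definition amplitude : R := ((P + 1) * (P + 2) / 2) `^ P^-1.

Lemma amplitude_pow : amplitude ^+ p = (P + 1) * (P + 2) / 2.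
Proof.
rewrite /amplitude -powR_mulrn ?powR_ge0 // -powRrM mulVf ?gt_eqF // powRr1 //.
Qed.

Local Notation phi := (@soliton R p).

Lemma solitonE x : phi x = amplitude * profile x. Proof. by []. Qed.

Lemma soliton_even x : phi (- x) = phi x.
Proof. by rewrite !solitonE profile_even. Qed.

Lemma soliton_pow x : phi x ^+ p = (P + 1) * (P + 2) / 2 * (1 - tnh x ^+ 2).
Proof. by rewrite solitonE exprMn amplitude_pow profile_pow. Qed.

Definition dsoliton x := - tnh x * phi x.

Lemma drv_soliton : drv phi dsoliton.
Proof.
apply: drv_ext; first exact: (drvZ amplitude drv_profile).
by move=> x /=; rewrite /dsoliton solitonE; ring.
Qed.

(** Since [dsoliton] is [- tnh] times the soliton, this second derivative is the
    soliton times a polynomial in [tnh], and so is the nonlinearity by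
    [soliton_pow]. *)
Lemma drv_dsoliton : drv dsoliton (fun x => phi x - (P + 1)^-1 * phi x ^+ p.+1).
Proof.
apply: drv_ext; first exact: (drvM (drvN drv_tnh) drv_soliton).
move=> x /=; rewrite exprS soliton_pow /dsoliton /tnh'.
by field; rewrite gt_eqF // ltr_wpDl ?ltW.
Qed.

Lemma dom_profile : dom profile 16.
Proof.
apply: dom_sym => x; first by rewrite profile_even.
move=> x0; rewrite gtr0_norm ?profile_gt0 //; apply: le_trans (profile_le x0) _.
have h := exp_le_wgt x0; have e0 := expR_gt0 (- (x / 2)); have W := wgt_gt0 x.
have e1 : expR (- (x / 2)) <= 1 by rewrite expR_le1 oppr_le0 divr_ge0.
have -> : - x = - (x / 2) + - (x / 2) by field.
by rewrite expRD; nra.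
Qed.

Lemma amplitude_ge0 : 0 <= amplitude. Proof. exact: powR_ge0. Qed.

Lemma dom_soliton : dom phi (amplitude * 16).
Proof.
by have := domZ amplitude dom_profile; rewrite ger0_norm ?amplitude_ge0.
Qed.

Lemma dom_dsoliton : dom dsoliton (amplitude * 16).
Proof.
rewrite -[_ * _]mul1r; apply: domM => //; last exact: dom_soliton.
by move=> x; rewrite normrN tnh_le1.
Qed.

(** The operator [- D^2 + pot] is the linearisation at the soliton of
    [v |-> - v'' + v - v ^+ p.+1 / (p + 1)]. *)
Definition pot x : R := 1 - phi x ^+ p.

Definition mode_coef : R := (P + 4) / 2.

Let I := prim (fun x => (profile x) ^- 2).

Let cont_profileV2 : continuous (fun x => (profile x) ^- 2).
Proof.
rewrite (_ : (fun x => _) = fun x => (profile x)^-1 ^+ 2).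
  exact: contX (drv_continuous drv_profileV).
by apply/funext => x; rewrite exprVn.
Qed.

Let drv_I : drv I (fun x => (profile x) ^- 2). Proof. by have [] := primP cont_profileV2. Qed.

(** Up to a factor, the derivative of the soliton. *)
Definition odd_mode x := tnh x * profile x.
Definition odd_mode' x := (tnh' x - tnh x ^+ 2) * profile x.

(** With [l = 1 + 2/p], [y = p x / 2], [A_l = d/dy + l tanh y] and [A_l'] the
    formal adjoint of [A_l], the linearised operator [L] satisfies
    [L A_l' = (p^2 / 4) A_l' A_(l-1)' A_(l-1)].  Hence [A_l' z] is in its kernel
    as soon as [A_(l-1) z] is in the kernel of [A_(l-1)'], spanned by
    [cosh^(l-1) = 1 / profile]; the choice [z 0 = 0] gives an even function. *)
Definition even_mode x := mode_coef * tnh x * profile x * I x - (profile x)^-1.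
Definition even_mode' x :=
  mode_coef * (tnh' x - tnh x ^+ 2) * profile x * I x + (mode_coef - 1) * tnh x / profile x.

Let profile_neq0 x : profile x != 0. Proof. by rewrite gt_eqF ?profile_gt0. Qed.

Let potE x : pot x = 1 - (P + 1) * (P + 2) / 2 * (1 - tnh x ^+ 2).
Proof. by rewrite /pot soliton_pow. Qed.

Let drv_tnh' : drv tnh' (fun x => - P * tnh x * tnh' x).
Proof.
apply: drv_ext.
  exact: (drvZ (P / 2) (drvB (drv_cst 1) (drvX 1 drv_tnh))).
by move=> x /=; field.
Qed.

Lemma drv_odd_mode : drv odd_mode odd_mode'.
Proof.
apply: drv_ext; first exact: (drvM drv_tnh drv_profile).
by move=> x /=; rewrite /odd_mode'; ring.
Qed.

Lemma drv_odd_mode' : drv odd_mode' (fun x => pot x * odd_mode x).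
Proof.
apply: drv_ext; first exact: (drvM (drvB drv_tnh' (drvX 1 drv_tnh)) drv_profile).
by move=> x /=; rewrite potE /odd_mode /tnh'; field.
Qed.

Lemma drv_even_mode : drv even_mode even_mode'.
Proof.
apply: drv_ext.
  exact: (drvB (drvM (drvM (drvZ mode_coef drv_tnh) drv_profile) drv_I) drv_profileV).
by move=> x /=; rewrite /even_mode'; field.
Qed.

Lemma drv_even_mode' : drv even_mode' (fun x => pot x * even_mode x).
Proof.
apply: drv_ext.
  exact: (drvD
    (drvM (drvM (drvZ mode_coef (drvB drv_tnh' (drvX 1 drv_tnh))) drv_profile) drv_I)
    (drvM (drvZ (mode_coef - 1) drv_tnh) drv_profileV)).
by move=> x /=; rewrite potE /even_mode /mode_coef /tnh'; field.
Qed.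

Lemma wronskian x : odd_mode' x * even_mode x - odd_mode x * even_mode' x = - (P / 2).
Proof. by rewrite /odd_mode /odd_mode' /even_mode /even_mode' /mode_coef /tnh'; field. Qed.

Lemma odd_mode_odd x : odd_mode (- x) = - odd_mode x.
Proof. by rewrite /odd_mode tnh_odd profile_even mulNr. Qed.

Lemma even_mode_even x : even_mode (- x) = even_mode x.
Proof.
have I_odd : I (- x) = - I x.
  by apply: (prim_odd cont_profileV2) => y; rewrite profile_even.
by rewrite /even_mode tnh_odd profile_even I_odd; ring.
Qed.

Definition mode_bound : R := 4 * (mode_coef + 1) * (P + 2).

Let tnhc_le x : `|tnh' x - tnh x ^+ 2| <= P / 2 + 1.
Proof.
have h := tnh2_le1 x; have h0 : 0 <= tnh x ^+ 2 by exact: sqr_ge0.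
rewrite /tnh' ler_norml; have := P_gt0.
by move: h h0; set t := tnh x ^+ 2 => *; apply/andP; split; nra.
Qed.

Let I_le x : 0 <= x -> `|I x| <= expR x ^+ 2.
Proof.
move=> x0; have [_ I0] := primP cont_profileV2.
have de : drv (fun y : R => expR y ^+ 2) (fun y => 2 * expR y ^+ 2).
  apply: drv_ext; first exact: (drvX 1 (drv_expR (@drv_id R))).
  by move=> y /=; ring.
have up : 0 <= expR x ^+ 2 - I x.
  apply: (@le_trans _ _ (expR 0 ^+ 2 - I 0)).
    by rewrite /I I0 subr0 expR0 expr1n.
  apply: (drv_ge0 (a := 0) (drvB de drv_I)) => // y y0.
  have h := profileV_le y0; have hp : 0 < (profile y)^-1 by rewrite invr_gt0 profile_gt0.
  rewrite -exprVn; have : (profile y)^-1 ^+ 2 <= expR y ^+ 2.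
    by rewrite lerXn2r // nnegrE ?expR_ge0 // ltW.
  by have := sqr_ge0 (expR y); lra.
have lo : 0 <= I x.
  have {1}<- : I 0 = 0 by exact: I0.
  apply: (drv_ge0 (a := 0) drv_I) => // y y0.
  by rewrite invr_ge0 exprn_ge0 // ltW ?profile_gt0.
by rewrite ger0_norm //; lra.
Qed.

Let profileI_le x : 0 <= x -> `|profile x * I x| <= 4 * expR x.
Proof.
move=> x0; rewrite normrM (gtr0_norm (profile_gt0 x)).
apply: le_trans (ler_pM (ltW (profile_gt0 x)) (normr_ge0 _) (profile_le x0) (I_le x0)) _.
have := expRxMexpNx_1 x; set a := expR x; set c := expR (- x) => ac.
rewrite (_ : 4 * c * a ^+ 2 = a * c * (4 * a)); last by ring.
by rewrite ac mul1r.
Qed.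

Lemma odd_mode_le x : 0 <= x -> `|odd_mode x| <= mode_bound * expR (- x).
Proof.
move=> x0; rewrite normrM (gtr0_norm (profile_gt0 x)).
have h := profile_le x0; have ht := tnh_le1 x; have e0 := expR_gt0 (- x).
have h1 : `|tnh x| * profile x <= 1 * (4 * expR (- x)).
  by rewrite ler_pM // ltW ?profile_gt0.
apply: le_trans h1 _; rewrite mul1r ler_pM2r // /mode_bound /mode_coef.
by have := P_ge1; nra.
Qed.

Lemma odd_mode'_le x : 0 <= x -> `|odd_mode' x| <= mode_bound * expR (- x).
Proof.
move=> x0; rewrite normrM (gtr0_norm (profile_gt0 x)).
have h := profile_le x0; have ht := tnhc_le x; have e0 := expR_gt0 (- x).
have h1 : `|tnh' x - tnh x ^+ 2| * profile x <= (P / 2 + 1) * (4 * expR (- x)).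
  by rewrite ler_pM // ltW ?profile_gt0.
apply: le_trans h1 _; rewrite mulrA ler_pM2r // /mode_bound /mode_coef.
by have := P_ge1; nra.
Qed.

Lemma even_mode_le x : 0 <= x -> `|even_mode x| <= mode_bound * expR x.
Proof.
move=> x0; have e0 := expR_gt0 x; rewrite /even_mode.
have k0 : 0 <= mode_coef by rewrite /mode_coef; have := P_ge1; lra.
have h1 : `|mode_coef * tnh x * profile x * I x| <= mode_coef * 1 * (4 * expR x).
  rewrite -mulrA normrM normrM (ger0_norm k0) ler_pM ?mulr_ge0 //.
    by rewrite ler_wpM2l // tnh_le1.
  exact: profileI_le.
have h2 := profileV_le x0; have hp : 0 < (profile x)^-1 by rewrite invr_gt0 profile_gt0.
apply: le_trans (ler_normB _ _) _; rewrite (gtr0_norm hp).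
have hu : 4 * mode_coef + 1 <= mode_bound by rewrite /mode_bound; have := P_ge1; nra.
have : (4 * mode_coef + 1) * expR x <= mode_bound * expR x by rewrite ler_pM2r.
by lra.
Qed.

Lemma even_mode'_le x : 0 <= x -> `|even_mode' x| <= mode_bound * expR x.
Proof.
move=> x0; have e0 := expR_gt0 x; rewrite /even_mode'.
have k1 : 0 <= mode_coef - 1 by rewrite /mode_coef; have := P_ge1; lra.
have k0 : 0 <= mode_coef by lra.
have h1 : `|mode_coef * (tnh' x - tnh x ^+ 2) * profile x * I x| <=
    mode_coef * (P / 2 + 1) * (4 * expR x).
  rewrite -mulrA normrM normrM (ger0_norm k0) ler_pM ?mulr_ge0 //.
    by rewrite ler_wpM2l // tnhc_le.
  exact: profileI_le.
have hp : 0 < (profile x)^-1 by rewrite invr_gt0 profile_gt0.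
have h2 : `|(mode_coef - 1) * tnh x / profile x| <= (mode_coef - 1) * 1 * expR x.
  rewrite normrM normrM (ger0_norm k1) (gtr0_norm hp) ler_pM ?mulr_ge0 ?(ltW hp) //.
    by rewrite ler_wpM2l // tnh_le1.
  exact: profileV_le.
apply: le_trans (ler_normD _ _) _.
have hu : mode_coef * (P / 2 + 1) * 4 + (mode_coef - 1) <= mode_bound.
  by rewrite /mode_bound; have := P_ge1; nra.
have : (mode_coef * (P / 2 + 1) * 4 + (mode_coef - 1)) * expR x <= mode_bound * expR x.
  by rewrite ler_pM2r.
by lra.
Qed.

End SolitonProfile.

(** * The perturbed profile equation *)

Section PowerEstimates.
Variable R : realType.
Implicit Types x y z M : R.

Lemma powdiff_le M x y n : 1 <= M -> `|x| <= M -> `|y| <= M ->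
  `|x ^+ n - y ^+ n| <= n%:R * M ^+ n * `|x - y|.
Proof.
move=> M1 xM yM; have M0 : 0 <= M by lra.
elim: n => [|n IH]; first by rewrite !expr0 subrr normr0 mul0r mul0r.
have -> : x ^+ n.+1 - y ^+ n.+1 = x * (x ^+ n - y ^+ n) + (x - y) * y ^+ n.
  by rewrite !exprS; ring.
apply: le_trans (ler_normD _ _) _; rewrite !normrM normrX.
have h1 : `|x| * `|x ^+ n - y ^+ n| <= M * (n%:R * M ^+ n * `|x - y|) by rewrite ler_pM.
have h2 : `|y| ^+ n <= M ^+ n by rewrite lerXn2r // nnegrE.
have h3 : M ^+ n <= M ^+ n.+1 by rewrite ler_weXn2l.
have h4 : `|x - y| * `|y| ^+ n <= `|x - y| * M ^+ n.+1.
  by rewrite ler_wpM2l // (le_trans h2).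
apply: le_trans (lerD h1 h4) _.
by rewrite le_eqVlt; apply/orP; left; apply/eqP; rewrite exprS -[n.+1%:R]natr1; ring.
Qed.

(** By the mean value theorem the difference of the two values is
    [c ^+ n * (h1 - h2)] for some [c] at distance at most [e] from [z]. *)
Lemma pow_taylor M z h1 h2 e n : 1 <= M -> `|z| <= M -> `|z + h1| <= M ->
  `|z + h2| <= M -> `|h1| <= e -> `|h2| <= e ->
  `|n.+1%:R^-1 * (z + h1) ^+ n.+1 - n.+1%:R^-1 * (z + h2) ^+ n.+1
    - z ^+ n * (h1 - h2)| <= n%:R * M ^+ n * e * `|h1 - h2|.
Proof.
move=> M1; wlog h12 : h1 h2 / h2 <= h1.
  move=> H; case: (leP h2 h1) => [/H //|/ltW /H H' zM z1 z2 e1 e2].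
  have := H' zM z2 z1 e2 e1; rewrite (distrC h2); congr (_ <= _).
  by rewrite -normrN; congr `|_|; ring.
move=> zM z1 z2 e1 e2.
have dN : drv (fun u : R => n.+1%:R^-1 * u ^+ n.+1) (fun u => u ^+ n).
  apply: drv_ext; first exact: (drvZ n.+1%:R^-1 (drvX n (@drv_id R))).
  by move=> u /=; rewrite mulr1 mulKf // pnatr_eq0.
have le12 : z + h2 <= z + h1 by rewrite lerD2l.
have [c /andP[c2 c1] ->] := drv_MVT dN le12.
rewrite (_ : z + h1 - (z + h2) = h1 - h2); last by ring.
rewrite -mulrBl normrM ler_wpM2r //.
have cM : `|c| <= M.
  by move: z1 z2; rewrite !ler_norml => /andP[? ?] /andP[? ?]; apply/andP; split; lra.
apply: le_trans (powdiff_le n M1 cM zM) _.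
rewrite ler_wpM2l ?mulr_ge0 ?exprn_ge0 //; first by lra.
by move: e1 e2; rewrite !ler_norml => /andP[? ?] /andP[? ?]; apply/andP; split; lra.
Qed.

Lemma pow_lip M a c n : 1 <= M -> `|a| <= M -> `|c| <= M ->
  `|n.+1%:R^-1 * a ^+ n.+1 - n.+1%:R^-1 * c ^+ n.+1| <= M ^+ n * `|a - c|.
Proof.
move=> M1 aM cM; have M0 : 0 <= M by lra.
rewrite -mulrBr normrM ger0_norm ?invr_ge0 //.
suff H : `|a ^+ n.+1 - c ^+ n.+1| <= n.+1%:R * M ^+ n * `|a - c|.
  by rewrite mulrC ler_pdivrMr ?ltr0n // mulrC mulrA.
elim: n => [|n IH]; first by rewrite !expr1 expr0 !mul1r.
have -> : a ^+ n.+2 - c ^+ n.+2 = a * (a ^+ n.+1 - c ^+ n.+1) + (a - c) * c ^+ n.+1.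
  by rewrite !(exprS _ n.+1); ring.
apply: le_trans (ler_normD _ _) _; rewrite !normrM normrX.
have h1 : `|a| * `|a ^+ n.+1 - c ^+ n.+1| <= M * (n.+1%:R * M ^+ n * `|a - c|).
  by rewrite ler_pM.
have h2 : `|a - c| * `|c| ^+ n.+1 <= `|a - c| * M ^+ n.+1.
  by rewrite ler_wpM2l // lerXn2r // nnegrE.
apply: le_trans (lerD h1 h2) _.
by rewrite le_eqVlt; apply/orP; left; apply/eqP; rewrite exprS -[n.+2%:R]natr1; ring.
Qed.

End PowerEstimates.

(** Factorisation [1 - D^2 + mu D^4 = (1 - s^-1 D^2) (1 - b^-2 D^2)], with
    [s] close to 1 and [b] of order [mu ^ (-1/2)]. *)
Lemma dispersion_parameters (R : realType) (mu : R) :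
  0 < mu -> Num.sqrt mu <= 1 / 24 -> exists s b : R,
  [/\ [/\ 1 <= s, s <= 2 & s - 1 <= 4 * Num.sqrt mu],
      2^-1 < b /\ (b - 2^-1)^-1 <= 4 * Num.sqrt mu &
      mu * s ^+ 2 + 1 = s /\ mu * s * b ^+ 2 = 1].
Proof.
move=> mu_gt0; set t := Num.sqrt mu => t_small.
have t0 : 0 < t by rewrite sqrtr_gt0.
have t2 : t ^+ 2 = mu by rewrite sqr_sqrtr // ltW.
(* s is the root of mu s^2 - s + 1 that tends to 1 with mu. *)
pose D := Num.sqrt (1 - 4 * mu).
have D2 : D ^+ 2 = 1 - 4 * mu by rewrite sqr_sqrtr //; nra.
have D0 : 0 <= D by exact: sqrtr_ge0.
have D1 : D <= 1 by rewrite -sqrtr1 ler_wsqrtr //; lra.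
pose s := 2 / (1 + D).
have D1n : 1 + D != 0 by rewrite gt_eqF //; lra.
have sD : s * (1 + D) = 2 by rewrite /s mulfVK.
have s1 : 1 <= s by nra.
have s2 : s <= 2 by nra.
have mu_s : mu * s ^+ 2 + 1 = s.
  have -> : mu = (1 - D ^+ 2) / 4 by rewrite D2; field.
  by rewrite /s; field.
have ms : mu * s ^+ 2 <= 4 * mu by nra.
pose sg := Num.sqrt (mu * s).
have sg2 : sg ^+ 2 = mu * s by rewrite sqr_sqrtr // mulr_ge0 // ?ltW //; lra.
have sg0 : 0 < sg by rewrite sqrtr_gt0 mulr_gt0 //; lra.
have sgt : sg <= 3 / 2 * t.
  rewrite -(ler_pXn2r (_ : 0 < 2)%N) ?nnegrE ?sg2 //; [|exact: ltW|nra].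
  by rewrite exprMn t2; nra.
pose b := sg^-1.
have bsg : b * sg = 1 by rewrite mulVf // gt_eqF.
have b0 : 0 < b by rewrite invr_gt0.
have bt : 1 <= (b - 2^-1) * (4 * t) by nra.
have b_gt : 2^-1 < b by nra.
have b_eta : (b - 2^-1)^-1 <= 4 * t.
  by rewrite -[leLHS]mul1r ler_pdivrMr ?subr_gt0 // mulrC.
have mu_sb : mu * s * b ^+ 2 = 1.
  by rewrite -sg2 -exprMn mulrC bsg expr1n.
have s_eta : s - 1 <= 4 * t by nra.
by exists s, b.
Qed.

Section ProfileEquation.
Variables (R : realType) (p : nat).
Hypothesis p_gt0 : (0 < p)%N.
Local Notation P := (p%:R : R).
Local Notation phi := (@soliton R p).
Local Notation dphi := (@dsoliton R p).

Definition nonlin (u : R) : R := (P + 1)^-1 * u ^+ p.+1.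

Let drv_nonlin : drv nonlin (fun u => u ^+ p).
Proof.
apply: drv_ext; first exact: (drvZ (P + 1)^-1 (drvX p (@drv_id R))).
by move=> u /=; rewrite mulr1 natr1 mulKf // pnatr_eq0.
Qed.

(** The inverse of the linearised operator on even functions, and its
    derivative. *)
Definition linv : (R -> R) -> R -> R := green (odd_mode p) (even_mode p) (P / 2).
Definition dlinv : (R -> R) -> R -> R :=
  green' (odd_mode p) (odd_mode' p) (even_mode p) (even_mode' p) (P / 2).

Definition linv_gain : R := gain (P / 2) (mode_bound R p).
Local Notation K := linv_gain.

(** A bound for the soliton and for the candidates [phi + h] with [`|h| <= 1]. *)
Definition cand_bound : R := amplitude R p * 16 + 1.
Local Notation A := (amplitude R p * 16).
Local Notation M := cand_bound.

Let om_gt0 : 0 < P / 2. Proof. by rewrite divr_gt0 // ltr0n. Qed.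
Let K_ge0 : 0 <= K.
Proof. by rewrite /linv_gain /gain divr_ge0 ?(ltW om_gt0) // mulr_ge0 // sqr_ge0. Qed.
Let A_ge0 : 0 <= A. Proof. by rewrite mulr_ge0 // amplitude_ge0. Qed.
Let M_ge1 : 1 <= M. Proof. by rewrite /cand_bound; have := A_ge0; lra. Qed.
Let M_ge0 : 0 <= M. Proof. exact: le_trans M_ge1. Qed.

Let nonlin_lip a c : `|a| <= M -> `|c| <= M ->
  `|nonlin a - nonlin c| <= M ^+ p * `|a - c|.
Proof. by rewrite /nonlin natr1; exact: pow_lip. Qed.

(** The part of the nonlinearity of order at least two at the soliton. *)
Definition quad (x h : R) : R :=
  nonlin (phi x + h) - nonlin (phi x) - phi x ^+ p * h.

Let phi_le x : `|phi x| <= M.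
Proof.
have := dom_bounded x (@dom_soliton R p p_gt0).
by rewrite /cand_bound; lra.
Qed.

Let phih_le x h : `|h| <= 1 -> `|phi x + h| <= M.
Proof.
move=> h1; apply: le_trans (ler_normD _ _) _; rewrite /cand_bound lerD //.
exact: dom_bounded (@dom_soliton R p p_gt0).
Qed.

Let quad_dist x h1 h2 e : e <= 1 -> `|h1| <= e -> `|h2| <= e ->
  `|quad x h1 - quad x h2| <= P * M ^+ p * e * `|h1 - h2|.
Proof.
move=> e1 he1 he2.
have -> : quad x h1 - quad x h2 =
    nonlin (phi x + h1) - nonlin (phi x + h2) - phi x ^+ p * (h1 - h2).
  by rewrite /quad; ring.
rewrite /nonlin natr1; apply: pow_taylor => //; apply: phih_le.
  exact: le_trans e1.
exact: le_trans e1.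
Qed.

Let quad0 x : quad x 0 = 0.
Proof. by rewrite /quad addr0 subrr mulr0 subr0. Qed.

Definition admissible (c : R) (r : R -> R) :=
  [/\ continuous r, forall x, r (- x) = r x & dom r c].

Let drv_linv c r : admissible c r -> drv (linv r) (dlinv r).
Proof.
move=> [cr _ rc].
exact: (drv_green (P / 2) (drv_odd_mode p_gt0) (drv_even_mode p_gt0) (odd_mode_le p_gt0) cr rc).
Qed.

Let drv_dlinv c r : admissible c r ->
  drv (dlinv r) (fun x => pot p x * linv r x - r x).
Proof.
move=> [cr _ rc].
exact: (drv_green' (drv_odd_mode p_gt0) (drv_odd_mode' p_gt0) (drv_even_mode p_gt0) (drv_even_mode' p_gt0)
  (wronskian p) om_gt0 (odd_mode_le p_gt0) cr rc).
Qed.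

Let linv_even c r : admissible c r -> forall x, linv r (- x) = linv r x.
Proof.
move=> [cr re rc].
exact: (green_even (P / 2) (drv_odd_mode p_gt0) (drv_even_mode p_gt0) (odd_mode_odd p)
  (even_mode_even p_gt0) (odd_mode_le p_gt0) cr rc re).
Qed.

Let linv_dist r1 r2 c1 c2 c : admissible c1 r1 -> admissible c2 r2 ->
  dom (fun x => r1 x - r2 x) c ->
  dom (fun x => linv r1 x - linv r2 x) (K * c) /\
  dom (fun x => dlinv r1 x - dlinv r2 x) (K * c).
Proof.
move=> [cr1 re1 rc1] [cr2 re2 rc2] r12; split.
  exact: (green_dist (drv_odd_mode p_gt0) (drv_even_mode p_gt0) om_gt0 (odd_mode_odd p)
    (even_mode_even p_gt0) (odd_mode_le p_gt0) (even_mode_le p_gt0) cr1 cr2 rc1 rc2 r12 re1 re2).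
exact: (green'_dist (drv_odd_mode p_gt0) (drv_even_mode p_gt0) om_gt0 (odd_mode_odd p)
  (even_mode_even p_gt0) (odd_mode_le p_gt0) (odd_mode'_le p_gt0) (even_mode_le p_gt0) (even_mode'_le p_gt0)
  cr1 cr2 rc1 rc2 r12 re1 re2).
Qed.

Let dom_linv r c : admissible c r -> dom (linv r) (K * c) /\ dom (dlinv r) (K * c).
Proof.
move=> [cr re rc].
exact: (dom_green (drv_odd_mode p_gt0) (drv_even_mode p_gt0) om_gt0 (odd_mode_odd p)
  (even_mode_even p_gt0) (odd_mode_le p_gt0) (odd_mode'_le p_gt0) (even_mode_le p_gt0) (even_mode'_le p_gt0)
  cr rc re).
Qed.

(** The candidate solution attached to the source term [r], its derivative, and
    the derivative of its image under the nonlinearity. *)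
Definition cand (r : R -> R) x : R := phi x + linv r x.
Definition dcand (r : R -> R) x : R := dphi x + dlinv r x.
Definition dncand (r : R -> R) x : R := cand r x ^+ p * dcand r x.

Section SmallSource.
Variable delta : R.
Hypothesis K_delta : K * delta <= 1.

Let linv_le r x : admissible delta r -> `|linv r x| <= K * delta.
Proof. by move=> /dom_linv[h _]; exact: dom_bounded h. Qed.

Let dom_cand r : admissible delta r -> dom (cand r) M /\ dom (dcand r) M.
Proof.
move=> /dom_linv[h dh].
split; (apply: dom_le; last apply: domD; [|exact: dom_soliton|exact: h] ||
  (apply: dom_le; last apply: domD; [|exact: dom_dsoliton|exact: dh]));
  by rewrite /cand_bound lerD2l.
Qed.

Let cand_le r x : admissible delta r -> `|cand r x| <= M.
Proof. by move=> /dom_cand[h _]; exact: dom_bounded h. Qed.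

Let dcand_le r x : admissible delta r -> `|dcand r x| <= M.
Proof. by move=> /dom_cand[_ h]; exact: dom_bounded h. Qed.

Let drv_cand r : admissible delta r -> drv (cand r) (dcand r).
Proof. by move=> /drv_linv H; exact: (drvD (@drv_soliton R p p_gt0) H). Qed.

Let drv_ncand r : admissible delta r ->
  drv (fun x => nonlin (cand r x)) (dncand r).
Proof.
move=> /drv_cand H; apply: drv_ext; first exact: (drv_comp drv_nonlin H).
by move=> x /=; rewrite mulrC.
Qed.

Let cont_dncand r : admissible delta r -> continuous (dncand r).
Proof.
move=> H; have := drv_dlinv H; have := drv_cand H => h1 h2.
apply: contM; first exact: contX (drv_continuous h1).
exact: contD (drv_continuous (@drv_dsoliton R p p_gt0)) (drv_continuous h2).
Qed.

Let cand_even r : admissible delta r -> forall x, cand r (- x) = cand r x.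
Proof. by move=> H x; rewrite /cand soliton_even (linv_even H). Qed.

Let dncand_odd r : admissible delta r -> forall x, dncand r (- x) = - dncand r x.
Proof.
move=> H; apply: (drv_even_odd (drv_ncand H)) => x.
by rewrite (cand_even H).
Qed.

Let pow_cand_le r x : admissible delta r -> `|cand r x ^+ p| <= M ^+ p.
Proof. by move=> H; rewrite normrX lerXn2r ?nnegrE ?cand_le. Qed.

Let dom_dncand r : admissible delta r -> dom (dncand r) (M ^+ p * M).
Proof.
move=> H; apply: domM; first by rewrite exprn_ge0.
  by move=> x; exact: pow_cand_le.
by have [] := dom_cand H.
Qed.

Let dom_ncand r : admissible delta r ->
  dom (fun x => nonlin (cand r x)) (M ^+ p * M).
Proof.
move=> H x; have := nonlin_lip (cand_le x H) (_ : `|0| <= M).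
rewrite normr0 => /(_ M_ge0).
rewrite /nonlin (expr0n _ p.+1) mulr0 !subr0 => h; apply: le_trans h _.
by rewrite -mulrA ler_wpM2l ?exprn_ge0 //; have [/(_ x)] := dom_cand H.
Qed.

Variables (s b eta : R).
Hypotheses (s_ge1 : 1 <= s) (s_le2 : s <= 2) (s_eta : s - 1 <= eta).
Hypotheses (b_gt : 2^-1 < b) (b_eta : (b - 2^-1)^-1 <= eta).

(** The source term produced by a candidate: its fixed points give solutions of
    [- v'' + s v = s (1 - b^-2 D^2)^-1 nonlin v]. *)
Definition source (r : R -> R) x : R :=
  quad x (linv r x) + s * corr b (dncand r) x
  + (s - 1) * (nonlin (cand r x) - cand r x).

(** Coefficients in the estimates of [source]: its quadratic part has Lipschitz
    constant [source_quad * delta]; the other terms have Lipschitz constant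
    [source_lip * eta] and size [source_size * eta]. *)
Definition source_quad : R := P * M ^+ p * K ^+ 2.
Definition source_lip : R := 2 * (M ^+ p * K + P * M ^+ p * M * K) + (M ^+ p * K + K).
Definition source_size : R := 2 * (M ^+ p * M) + (M ^+ p * M + M).
Local Notation C1 := source_quad.
Local Notation C2 := source_lip.
Local Notation C3 := source_size.

Let Mp_ge0 : 0 <= M ^+ p. Proof. by rewrite exprn_ge0. Qed.

Let eta_ge0 : 0 <= eta. Proof. by move: s_eta s_ge1; lra. Qed.

Let source_even r : admissible delta r -> forall x, source r (- x) = source r x.
Proof.
move=> H x; rewrite /source /quad corr_even (cand_even H) (linv_even H).
by rewrite soliton_even.
Qed.

Let source_cont r : admissible delta r -> continuous (source r).
Proof.
move=> H; have cl := drv_continuous (drv_linv H).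
have cc := drv_continuous (drv_cand H).
have cp := drv_continuous (@drv_soliton R p p_gt0).
have cn (f : R -> R) : continuous f -> continuous (fun x => nonlin (f x)).
  by move=> cf; apply: contM; [exact: (drv_continuous (drv_cst _))|exact: contX].
have cst (k : R) : continuous (fun _ : R => k) := drv_continuous (drv_cst k).
apply: contD; last by apply: contM => //; apply: contB => //; exact: cn.
apply: contD; last first.
  by apply: contM => //; exact: corr_continuous (cont_dncand H) (dom_dncand H).
apply: contB; last by apply: contM => //; exact: contX.
by apply: contB; apply: cn.
Qed.

Let dom_corr_eta q c : continuous q -> dom q c -> dom (corr b q) (c * eta).
Proof.
move=> cq qc; apply: dom_le; last exact: (dom_corr b_gt cq qc).
by rewrite ler_wpM2l // (dom_ge0 qc).
Qed.

Let dom_source r : admissible delta r ->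
  dom (source r) (C1 * delta ^+ 2 + C3 * eta).
Proof.
move=> H; have [hl _] := dom_linv H.
have q : dom (fun x => quad x (linv r x)) (P * M ^+ p * (K * delta) * (K * delta)).
  move=> x; have := @quad_dist x (linv r x) 0 (K * delta) K_delta.
  rewrite normr0 quad0 !subr0 => h; apply: le_trans (h _ _) _.
  - exact: linv_le.
  - exact: dom_ge0 hl.
  rewrite -[leRHS]mulrA; apply: ler_wpM2l; last exact: hl.
  by apply: mulr_ge0; [rewrite mulr_ge0|exact: dom_ge0 hl].
have c : dom (fun x => s * corr b (dncand r) x) (2 * (M ^+ p * M * eta)).
  apply: (@domM _ (fun=> s)) => //; first by move=> _; rewrite ger0_norm // (le_trans _ s_ge1).
  exact: dom_corr_eta (cont_dncand H) (dom_dncand H).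
have n : dom (fun x => (s - 1) * (nonlin (cand r x) - cand r x))
    (eta * (M ^+ p * M + M)).
  apply: (@domM _ (fun=> s - 1)) => //.
    by move=> _; rewrite ger0_norm // subr_ge0.
  by apply: domB; [exact: dom_ncand|have [] := dom_cand H].
apply: dom_le; last exact: (domD (domD q c) n).
by rewrite le_eqVlt; apply/orP; left; apply/eqP; rewrite /source_quad /source_size; ring.
Qed.

Let source_dist r1 r2 m : admissible delta r1 -> admissible delta r2 ->
  dom (fun x => r1 x - r2 x) m ->
  dom (fun x => source r1 x - source r2 x) ((C1 * delta + C2 * eta) * m).
Proof.
move=> H1 H2 r12; have [hd dhd] := linv_dist H1 H2 r12.
have Kd0 : 0 <= K * delta by exact: dom_ge0 (dom_linv H1).1.
have q : dom (fun x => quad x (linv r1 x) - quad x (linv r2 x))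
    (P * M ^+ p * (K * delta) * (K * m)).
  move=> x /=; apply: le_trans (quad_dist x K_delta (linv_le x H1) (linv_le x H2)) _.
  rewrite -[leRHS]mulrA; apply: ler_wpM2l; last exact: hd.
  by apply: mulr_ge0; [rewrite mulr_ge0|].
have vd x : cand r1 x - cand r2 x = linv r1 x - linv r2 x.
  by rewrite /cand; ring.
have dd : dom (fun x => dncand r1 x - dncand r2 x)
    (M ^+ p * (K * m) + P * M ^+ p * M * (K * m)).
  move=> x /=; rewrite (_ : _ - _ =
    cand r1 x ^+ p * (dlinv r1 x - dlinv r2 x)
    + (cand r1 x ^+ p - cand r2 x ^+ p) * dcand r2 x); last first.
    by rewrite /dncand /dcand; ring.
  have W := ltW (wgt_gt0 x).
  apply: le_trans (ler_normD _ _) _; rewrite [leRHS]mulrDl lerD // normrM.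
    by rewrite -mulrA ler_pM ?pow_cand_le ?dhd.
  have h := powdiff_le p M_ge1 (cand_le x H1) (cand_le x H2).
  rewrite vd in h; apply: le_trans (ler_pM _ _ h (dcand_le x H2)) _ => //.
  rewrite (_ : P * M ^+ p * M * (K * m) * wgt x =
    P * M ^+ p * (K * m * wgt x) * M); last by ring.
  apply: ler_wpM2r => //; apply: ler_wpM2l; first by rewrite mulr_ge0.
  exact: hd.
have c : dom (fun x => s * (corr b (dncand r1) x - corr b (dncand r2) x))
    (2 * ((M ^+ p * (K * m) + P * M ^+ p * M * (K * m)) * eta)).
  apply: (@domM _ (fun=> s)) => //; first by move=> _; rewrite ger0_norm // (le_trans _ s_ge1).
  apply: dom_le; last exact: (corr_dist b_gt (cont_dncand H1) (cont_dncand H2)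
    (dom_dncand H1) (dom_dncand H2) dd).
  by rewrite ler_wpM2l // (dom_ge0 dd).
have n : dom (fun x => (s - 1) * (nonlin (cand r1 x) - nonlin (cand r2 x)
    - (linv r1 x - linv r2 x))) (eta * (M ^+ p * (K * m) + K * m)).
  apply: (@domM _ (fun=> s - 1)) => //.
    by move=> _; rewrite ger0_norm // subr_ge0.
  apply: domB => // x /=; apply: le_trans (nonlin_lip (cand_le x H1) (cand_le x H2)) _.
  by rewrite vd -mulrA ler_wpM2l.
move=> x; have := domD (domD q c) n x.
rewrite (_ : source r1 x - source r2 x = quad x (linv r1 x) - quad x (linv r2 x) +
  s * (corr b (dncand r1) x - corr b (dncand r2) x) +
  (s - 1) * (nonlin (cand r1 x) - nonlin (cand r2 x) - (linv r1 x - linv r2 x))).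
  move=> h; apply: le_trans h _.
  by rewrite le_eqVlt; apply/orP; left; apply/eqP; rewrite /source_quad /source_lip; ring.
by rewrite /source -vd; ring.
Qed.

Hypotheses (delta_ge0 : 0 <= delta)
  (stable : C1 * delta ^+ 2 + C3 * eta <= delta)
  (contracting : C1 * delta + C2 * eta <= 2^-1).

(** Continuity and evenness pass to uniform limits, as [wgt] is bounded. *)
Let source_fixed_point :
  exists2 r, admissible delta r & forall x, source r x = r x.
Proof.
pose X (r : R -> R) := continuous r /\ forall x, r (- x) = r x.
have adm r : X r -> dom r delta -> admissible delta r by move=> [].
have w0 x : 0 <= wgt x :> R by exact: ltW (wgt_gt0 x).
have [|u cl|r Xr rd|r1 r2 m X1 X2 d1 d2 d12|r [Xr rd fr]] :=
  @weighted_fixed_point R R (@wgt R) w0 X source delta _ delta_ge0.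
- by split=> //; exact: drv_continuous (drv_cst 0).
- split=> [x|x].
    apply/cvgrPdist_lt => e e0; have e3 : 0 < e / 3 by rewrite divr_gt0.
    have [v [cv _] uv] := cl _ e3.
    have uv' y : `|u y - v y| <= e / 3.
      by apply: le_trans (uv y) _; have := wgt_le1 y; nra.
    have /cvgrPdist_lt/(_ _ e3) := cv x; apply: filterS => y vxy.
    have := ler_normD (u x - v x) (v x - u y).
    have := ler_normD (v x - v y) (v y - u y).
    rewrite !subrKA; have := uv' x; have := uv' y; rewrite (distrC (u y)).
    by lra.
  apply/eqP; rewrite -subr_eq0 -normr_le0 leNgt; apply/negP => e0.
  have e3 : 0 < `|u (- x) - u x| / 3 by rewrite divr_gt0.
  have [v [_ ev] uv] := cl _ e3.
  have uv' y : `|u y - v y| <= `|u (- x) - u x| / 3.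
    by apply: le_trans (uv y) _; have := wgt_le1 y; nra.
  have := ler_normD (u (- x) - v (- x)) (v x - u x).
  rewrite ev subrKA; have := uv' x; have := uv' (- x).
  by rewrite ev (distrC (u x)); lra.
- have H := adm r Xr rd; split; first by split; [exact: source_cont|exact: source_even].
  exact: dom_le stable (dom_source H).
- move=> x; apply: le_trans (source_dist (adm _ X1 d1) (adm _ X2 d2) d12 x) _.
  rewrite ler_wpM2r // mulrC ler_wpM2l // (dom_ge0 d12) //.
by exists r => //; exact: adm.
Qed.

Variable mu : R.
Hypotheses (mu_sb : mu * s * b ^+ 2 = 1) (mu_s : mu * s ^+ 2 + 1 = s).

(** At a fixed point [r], the equation of [linv r] becomes
    [v'' = s (v - g)] for the candidate [v] and
    [g = (1 - b^-2 D^2)^-1 nonlin v]; differentiating twice and using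
    [g'' = b^2 (g - nonlin v)] eliminates [g]. *)
Lemma profile_solution : exists v0 v1 v2 v3 v4 : R -> R,
  [/\ [/\ drv v0 v1, drv v1 v2, drv v2 v3, drv v3 v4 & continuous v4],
      exists c, [/\ dom v0 c, dom v1 c, dom v2 c, dom v3 c & dom v4 c],
      forall x, v0 (- x) = v0 x,
      forall x, mu * v4 x - v2 x + v0 x = nonlin (v0 x) &
      dom (fun x => v0 x - phi x) (K * delta) /\
      dom (fun x => v1 x - dphi x) (K * delta)].
Proof.
have [r H fr] := source_fixed_point.
have [dc ddc] := dom_cand H; have dq := dom_dncand H; have cq := cont_dncand H.
have dn := dom_ncand H; have dN := drv_ncand H.
have [dg ddg] := resolvent b_gt dN cq dq (dncand_odd H).
have dco := dom_corr b_gt cq dq; have dfl := dom_flux b_gt cq dq.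
pose g x := nonlin (cand r x) + corr b (dncand r) x.
pose v2 x := s * (cand r x - g x).
pose v3 x := s * (dcand r x - flux b (dncand r) x).
pose v4 x := s * (v2 x - b ^+ 2 * corr b (dncand r) x).
have d1 : drv (dcand r) v2.
  apply: drv_ext; first exact: (drvD (@drv_dsoliton R p p_gt0) (drv_dlinv H)).
  move=> x /=; rewrite /v2 /g -(fr x) /source /quad /pot /cand /nonlin.
  by ring.
have d2 : drv v2 v3 by exact: (drvZ s (drvB (drv_cand H) dg)).
have d3 : drv v3 v4 by exact: (drvZ s (drvB d1 ddg)).
have [c2 D2] : exists c, dom v2 c by eexists; exact: domZ (domB dc (domD dn dco)).
have [c3 D3] : exists c, dom v3 c by eexists; exact: domZ (domB ddc dfl).
have [c4 D4] : exists c, dom v4 c by eexists; exact: domZ (domB D2 (domZ _ dco)).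
exists (cand r), (dcand r), v2, v3, v4; split.
- split=> //; first exact: drv_cand.
  apply: contM; first exact: (drv_continuous (drv_cst _)).
  apply: contB; first exact: drv_continuous d2.
  apply: contM; first exact: (drv_continuous (drv_cst _)).
  exact: corr_continuous cq dq.
- have z2 := dom_ge0 D2; have z3 := dom_ge0 D3; have z4 := dom_ge0 D4.
  exists (M + c2 + c3 + c4); split.
  + by apply: dom_le dc; have := M_ge0; lra.
  + by apply: dom_le ddc; have := M_ge0; lra.
  + by apply: dom_le D2; have := M_ge0; lra.
  + by apply: dom_le D3; have := M_ge0; lra.
  + by apply: dom_le D4; have := M_ge0; lra.
- exact: cand_even.
- move=> x; have s0 : s != 0 by rewrite gt_eqF // (lt_le_trans _ s_ge1).
  have e : mu * s = 1 - s^-1.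
    by apply: (mulIf s0); rewrite mulrBl mulVf // mul1r; move: mu_s; lra.
  have ec : corr b (dncand r) x = cand r x - v2 x / s - nonlin (cand r x).
    by rewrite /v2 /g; field.
  rewrite /v4 (_ : mu * _ =
    mu * s * v2 x - mu * s * b ^+ 2 * corr b (dncand r) x); last by ring.
  by rewrite mu_sb mul1r e ec; ring.
have [hl dhl] := dom_linv H.
by split=> x; rewrite /cand /dcand addrAC subrr add0r.
Qed.

End SmallSource.

(** The small parameter is [eta = 4 sqrt mu] and the ball for the source has
    radius [delta = 2 Q eta], where [Q] dominates all constants: the error
    [source_size * eta] at the soliton is at most [delta / 2], and the quadratic
    part contributes at most [source_quad * delta ^+ 2 <= delta / 2]. *)
Lemma profile_exists : exists mu0 C : R, [/\ 0 < mu0, 0 <= C &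
  forall mu : R, 0 < mu < mu0 -> exists v0 v1 v2 v3 v4 : R -> R,
  [/\ [/\ drv v0 v1, drv v1 v2, drv v2 v3, drv v3 v4 & continuous v4],
      exists c, [/\ dom v0 c, dom v1 c, dom v2 c, dom v3 c & dom v4 c],
      forall x, v0 (- x) = v0 x,
      forall x, mu * v4 x - v2 x + v0 x = nonlin (v0 x) &
      dom (fun x => v0 x - phi x) (C * Num.sqrt mu) /\
      dom (fun x => v1 x - dphi x) (C * Num.sqrt mu)]].
Proof.
pose Q : R := source_quad + source_lip + source_size + K + 1.
have Mp : 0 <= M ^+ p by rewrite exprn_ge0.
have q1 : 0 <= source_quad by rewrite /source_quad mulr_ge0 ?sqr_ge0 // mulr_ge0.
have mk : 0 <= M ^+ p * K by exact: mulr_ge0.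
have pm : 0 <= P * M ^+ p by exact: mulr_ge0.
have pmm : 0 <= P * M ^+ p * M by exact: mulr_ge0.
have pmk : 0 <= P * M ^+ p * M * K by exact: mulr_ge0.
have mm : 0 <= M ^+ p * M by exact: mulr_ge0.
have q2 : 0 <= source_lip by rewrite /source_lip; have := K_ge0; lra.
have q3 : 0 <= source_size by rewrite /source_size; have := M_ge0; lra.
have Q1 : 1 <= Q by rewrite /Q; have := K_ge0; lra.
have Q2 : 1 <= Q ^+ 2 by rewrite exprn_ege1.
(* Below this threshold for sqrt mu, 3 Q^2 eta <= 1/2. *)
pose T : R := (24 * Q ^+ 2)^-1.
have T0 : 0 < T by rewrite invr_gt0; lra.
have TQ : T * (24 * Q ^+ 2) = 1 by rewrite mulVf // gt_eqF //; lra.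
exists (T ^+ 2), (8 * K * Q); split.
- by rewrite exprn_gt0.
- by apply: mulr_ge0; [rewrite mulr_ge0|lra].
move=> mu /andP[mu_gt0 mu_T].
set t := Num.sqrt mu; have t0 : 0 < t by rewrite sqrtr_gt0.
have t2 : t ^+ 2 = mu by rewrite sqr_sqrtr // ltW.
have tT : t < T by rewrite -(ltr_pXn2r (_ : 0 < 2)%N) ?nnegrE ?t2 // ltW.
have tQ : t * (24 * Q ^+ 2) <= 1 by rewrite -[leRHS]TQ ler_pM2r ?ltW //; lra.
have t_small : t <= 1 / 24.
  have : t * (24 * 1) <= t * (24 * Q ^+ 2) by rewrite ler_pM2l // ler_pM2l.
  by lra.
have [s [b [[s1 s2 s_eta] [b_gt b_eta] [mu_s mu_sb]]]] :=
  dispersion_parameters mu_gt0 t_small.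
pose delta := 2 * Q * (4 * t).
have QK : K <= Q by rewrite /Q; lra.
have Kd : K * delta <= 1 by rewrite /delta; have := K_ge0; nra.
have d0 : 0 <= delta by rewrite /delta; nra.
have st : source_quad * delta ^+ 2 + source_size * (4 * t) <= delta.
  have h1 : source_quad * delta <= 2^-1.
    apply: (@le_trans _ _ (Q * delta)); last by rewrite /delta; nra.
    by rewrite ler_wpM2r // /Q; have := K_ge0; lra.
  have h2 : source_size * (4 * t) <= Q * (4 * t).
    by rewrite ler_wpM2r ?mulr_ge0 ?ltW // /Q; have := K_ge0; lra.
  have h3 : source_quad * delta ^+ 2 <= 2^-1 * delta.
    by rewrite expr2 mulrA ler_wpM2r.
  by rewrite /delta in h3 *; lra.
have ct : source_quad * delta + source_lip * (4 * t) <= 2^-1.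
  have h1 : source_quad * delta <= Q * delta.
    by rewrite ler_wpM2r // /Q; have := K_ge0; lra.
  have h2 : source_lip * (4 * t) <= Q * (4 * t).
    by rewrite ler_wpM2r ?mulr_ge0 ?ltW // /Q; have := K_ge0; lra.
  have h3 : Q * (4 * t) <= Q ^+ 2 * (4 * t).
    by rewrite ler_pM2r ?mulr_gt0 // expr2 ler_peMl //; lra.
  by rewrite /delta in h1 *; lra.
rewrite (_ : 8 * K * Q * t = K * delta); last by rewrite /delta; ring.
have H := profile_solution Kd s1 s2 s_eta b_gt b_eta d0 st ct mu_sb mu_s.
exact: H.
Qed.

End ProfileEquation.

(** * Smooth functions with compact support *)

Section SmoothBumps.
Variable R : realType.
Implicit Types f g psi : R -> R.

Fixpoint diffn (n : nat) f : Prop :=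
  if n is m.+1 then exists2 f', drv f f' & diffn m f' else True.

Lemma diffnW n f : diffn n.+1 f -> diffn n f.
Proof.
elim: n f => [//|n IH] f [f' df cf']; exists f' => //; exact: IH.
Qed.

Lemma diffnD n f g : diffn n f -> diffn n g -> diffn n (fun x => f x + g x).
Proof.
elim: n f g => [//|n IH] f g [f' df cf] [g' dg cg].
by exists (fun x => f' x + g' x); [exact: drvD|exact: IH].
Qed.

Lemma diffnZ n c f : diffn n f -> diffn n (fun x => c * f x).
Proof.
elim: n f => [//|n IH] f [f' df cf].
by exists (fun x => c * f' x); [exact: drvZ|exact: IH].
Qed.

Lemma diffnM n f g : diffn n f -> diffn n g -> diffn n (fun x => f x * g x).
Proof.
elim: n f g => [//|n IH] f g Hf Hg; have := diffnW Hf; have := diffnW Hg.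
case: Hf Hg => [f' df cf] [g' dg cg] wg wf.
exists (fun x => f' x * g x + f x * g' x); first exact: drvM.
by apply: diffnD; exact: IH.
Qed.

Lemma diffn_affine n f a c : diffn n f -> diffn n (fun x => f (a * x + c)).
Proof.
elim: n f => [//|n IH] f [f' df cf].
exists (fun x => a * f' (a * x + c)); last by apply: diffnZ; exact: IH.
have dl : drv (fun x : R => a * x + c) (fun _ => a).
  apply: drv_ext; first exact: (drvD (drvZ a (@drv_id R)) (drv_cst c)).
  by move=> x /=; rewrite mulr1 addr0.
exact: (drv_comp df dl).
Qed.

Lemma diffn_derivable f : (forall n, diffn n f) ->
  forall n x, derivable (f^`(n))%classic x 1.
Proof.
have H n g : diffn n.+1 g -> forall x, derivable (g^`(n))%classic x 1.
  elim: n g => [|n IH] g [g' dg cg] x; first by exact: drv_derivable dg.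
  by rewrite derive1Sn (drv_derive1 dg); exact: IH.
by move=> Hf n; exact: H.
Qed.

(** The functions [expR (- 1 / x) / x ^ k] on positive reals, extended by zero:
    the class of their combinations is stable under differentiation. *)
Definition flat (k : nat) (x : R) : R :=
  if 0 < x then x^-1 ^+ k * expR (- x^-1) else 0.

Let exp_bound k (y : R) : 0 <= y -> y ^+ k <= k`!%:R * expR y.
Proof.
move=> y0; case: k => [|k].
  by rewrite expr0 fact0 mul1r; apply: le_trans (expR_ge1Dx y); rewrite lerDl.
rewrite mulrC -ler_pdivrMr ?ltr0n ?fact_gt0 //.
by apply: le_trans (expR_ge1Dxn k y0); rewrite lerDr.
Qed.

Let flat_small k (x : R) : `|flat k x| <= k.+2`!%:R * x ^+ 2.
Proof.
rewrite /flat; case: ifPn => [x0|_]; last first.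
  by rewrite normr0 mulr_ge0 ?sqr_ge0.
have y0 : 0 < x^-1 by rewrite invr_gt0.
rewrite ger0_norm ?mulr_ge0 ?expR_ge0 ?exprn_ge0 ?(ltW y0) //.
rewrite expRN ler_pdivrMr ?expR_gt0 //.
have -> : x^-1 ^+ k = x^-1 ^+ k.+2 * x ^+ 2.
  by rewrite -addn2 exprD -mulrA -exprMn mulVf ?gt_eqF // expr1n mulr1.
rewrite [leRHS]mulrAC; apply: ler_wpM2r; first exact: sqr_ge0.
by apply: exp_bound; exact: ltW.
Qed.

(** At the origin the difference quotient of flat k is bounded by a multiple of
   its argument, by flat_small. *)
Let flat_deriv0 k : is_derive (0 : R) (1 : R) (flat k) 0.
Proof.
apply/is_derive1_caratheodory; exists (fun z => flat k z / z); split.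
- move=> z; rewrite subr0 {2}/flat ltxx subr0.
  have [->|z0] := eqVneq z 0; last by rewrite mulfVK.
  by rewrite mulr0 /flat ltxx.
- apply/cvgrPdist_lt => e e0; rewrite invr0 mulr0.
  pose c : R := k.+2`!%:R; have c0 : 0 < c by rewrite ltr0n fact_gt0.
  have ec : 0 < e / c by rewrite divr_gt0.
  near=> z; rewrite sub0r normrN normrM normfV.
  have zs : `|z| < e / c.
    by rewrite -normrN -sub0r; near: z; apply: (@cvgr_dist_lt _ _ _ (nbhs 0) _ id) => //; exact: cvg_id.
  have [->|z0] := eqVneq z 0; first by rewrite normr0 invr0 mulr0.
  have nz : 0 < `|z| by rewrite normr_gt0.
  rewrite ltr_pdivrMr //; apply: le_lt_trans (flat_small k z) _.
  rewrite -real_normK ?num_real // expr2 mulrA ltr_pM2r // mulrC.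
  by rewrite -ltr_pdivlMr.
- by rewrite invr0 mulr0.
Unshelve. all: by end_near. Qed.

Let flat_pos k x : 0 < x -> flat k x = x^-1 ^+ k * expR (- x^-1).
Proof. by rewrite /flat => ->. Qed.

Let flat_neg k x : x <= 0 -> flat k x = 0.
Proof. by rewrite /flat leNgt => /negbTE ->. Qed.

Lemma drv_flat k : drv (flat k) (fun x => - k%:R * flat k.+1 x + flat k.+2 x).
Proof.
move=> x; have [x0|x0|->] := ltgtP x 0.
- rewrite (flat_neg _ (ltW x0)) (flat_neg _ (ltW x0)) mulr0 addr0.
  apply: (@near_eq_is_derive _ _ _ (cst 0)).
  by near=> z; apply/esym/flat_neg/ltW; near: z; exact: lt_nbhsl.
- have x1 : x != 0 by rewrite gt_eqF.
  have dV : is_derive x 1 (fun z : R => z^-1) (- x ^- 2).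
    have := @is_deriveV _ id x 1 1 x1 (is_derive_id _ _).
    by move/is_derive_eq; apply; rewrite /GRing.scale /= mulr1.
  have dE : is_derive x 1 (fun z : R => expR (- z^-1)) (expR (- x^-1) * x ^- 2).
    have := @is_derive1_comp R expR (fun z => - z^-1) x _ _ (is_derive_expR _) (is_deriveN dV).
    by move/is_derive_eq; apply; rewrite opprK.
  have dX : is_derive x 1 (fun z : R => z^-1 ^+ k) (k%:R * x^-1 ^+ k.-1 * (- x ^- 2)).
    by rewrite -exprfctE; exact: is_deriveX dV.
  have HD : is_derive x 1 (fun z : R => z^-1 ^+ k * expR (- z^-1))
      (- k%:R * flat k.+1 x + flat k.+2 x).
    have := is_deriveM dX dE; move/is_derive_eq; apply.
    rewrite !flat_pos // /GRing.scale /= -!exprVn.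
    case: (k) => [|m]; first by rewrite !expr0; ring.
    by rewrite /= !exprS; ring.
  apply: (near_eq_is_derive _ HD).
  by near=> z; apply/esym/flat_pos; near: z; exact: lt_nbhsr.
- by rewrite !(flat_neg _ (lexx 0)) mulr0 addr0; exact: flat_deriv0.
Unshelve. all: by end_near. Qed.

Lemma diffn_flat n k : diffn n (flat k).
Proof.
elim: n k => [//|n IH] k; exists (fun x => - k%:R * flat k.+1 x + flat k.+2 x).
  exact: drv_flat.
by apply: diffnD; [apply: diffnZ|].
Qed.

(** A smooth function supported by [[a, c]], with values in [[0, 1]], that
    increases to 1 on [ ]a, c[ ] as [n] grows, since [flat 0] tends to 1 at
    infinity. *)
Definition bump (a c : R) (n : nat) (x : R) : R :=
  flat 0 (n.+1%:R * (x - a)) * flat 0 (n.+1%:R * (c - x)).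

Lemma flat0_ge0 x : 0 <= flat 0 x.
Proof. by rewrite /flat; case: ifP => // _; rewrite expr0 mul1r expR_ge0. Qed.

Lemma flat0_le1 x : flat 0 x <= 1.
Proof.
rewrite /flat; case: ifPn => // x0; rewrite expr0 mul1r expR_le1 oppr_le0.
by rewrite invr_ge0 ltW.
Qed.

Lemma bump_out a c n x : ~~ (a < x < c) -> bump a c n x = 0.
Proof.
rewrite negb_and -!leNgt /bump => /orP[xa|cx].
  by rewrite (flat_neg 0 (_ : _ * (x - a) <= 0)) ?mul0r // pmulr_rle0 ?ltr0n // subr_le0.
by rewrite (flat_neg 0 (_ : _ * (c - x) <= 0)) ?mulr0 // pmulr_rle0 ?ltr0n // subr_le0.
Qed.

Lemma bump_norm_le1 a c n x : `|bump a c n x| <= 1.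
Proof.
by rewrite ger0_norm ?mulr_ge0 ?flat0_ge0 // mulr_ile1 ?flat0_ge0 ?flat0_le1.
Qed.

Lemma bump_test a c n : test_function (bump a c n).
Proof.
split.
  apply: diffn_derivable => m; apply: diffnM.
    rewrite (_ : (fun x => _) = fun x => flat 0 (n.+1%:R * x + - (n.+1%:R * a))).
      by apply: diffn_affine; exact: diffn_flat.
    by apply/funext => x; rewrite mulrBr.
  rewrite (_ : (fun x => _) = fun x => flat 0 (- n.+1%:R * x + n.+1%:R * c)).
    by apply: diffn_affine; exact: diffn_flat.
  by apply/funext => x; congr flat; ring.
apply: (@subclosed_compact _ _ `[a, c]%classic).
- exact: closed_closure.
- exact: segment_compact.
- rewrite [X in _ `<=` X](iffLR (closure_id _)
    (@interval_closed R (BLeft a) (BRight c) isT isT)).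
  apply: closureS => y /= h; rewrite in_itv /=; apply: contra_neqT h => h.
  by apply: bump_out; apply: contra h => /andP[/ltW-> /ltW->].
Qed.

Lemma bump_cvg a c x : a < x < c -> bump a c n x @[n --> \oo] --> (1 : R).
Proof.
move=> /andP[ax xc].
have F (u : R) : 0 < u -> flat 0 (n.+1%:R * u) @[n --> \oo] --> (1 : R).
  move=> u0.
  have H0 : (- (harmonic n * u^-1)) @[n --> \oo] --> (0 : R).
    have -> : 0 = - (0 * u^-1) :> R by rewrite mul0r oppr0.
    by apply: cvgN; apply: cvgMl; exact: cvg_harmonic.
  have := continuous_cvg _ (@continuous_expR R 0) H0; rewrite expR0 => H.
  have fE : (fun n : nat => flat 0 (n.+1%:R * u)) =
      fun n => expR (- (harmonic n * u^-1)).
    by apply/funext => n; rewrite /= flat_pos ?mulr_gt0 ?ltr0n // expr0 mul1r invfM.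
  by rewrite fE; exact: H.
have ua : 0 < x - a by rewrite subr_gt0.
have uc : 0 < c - x by rewrite subr_gt0.
rewrite -[X in _ --> X](mulr1 1); exact: cvgM (F _ ua) (F _ uc).
Qed.

End SmoothBumps.

(** * Weak derivatives of classically differentiable functions *)

Section WeakDerivative.
Variable R : realType.
Local Notation mu := (@lebesgue_measure R).
Implicit Types f g psi : R -> R.

Lemma continuous_locally_integrable f : continuous f ->
  locally_integrable [set: R] f.
Proof.
move=> cf; split; [exact: continuous_measurable_fun|exact: openT|].
move=> K _ cK; have /integrableP[_] : mu.-integrable K (EFin \o f).
  by apply: continuous_compact_integrable => //; exact: continuous_subspaceT.
by [].
Qed.

Lemma locally_integrable_itv f a c : locally_integrable [set: R] f ->
  mu.-integrable `[a, c] (EFin \o f).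
Proof.
move=> [mf _ intf]; apply/integrableP; split.
  by apply/measurable_EFinP; exact: measurable_funTS.
by apply: intf => //; exact: segment_compact.
Qed.

Lemma test_function_drv psi n : test_function psi ->
  drv (psi^`(n))%classic (psi^`(n.+1))%classic.
Proof.
move=> [dpsi _] x; rewrite derive1nS derive1E; exact: derivableP.
Qed.

Lemma test_function_support psi : test_function psi ->
  exists2 N : R, 0 < N & forall x, N < `|x| -> psi x = 0.
Proof.
move=> [_ /compact_bounded[M [_ HM]]]; exists (`|M| + 1) => [|x xN].
  by rewrite ltr_wpDl.
apply/eqP; apply: contraLR xN => px; rewrite -leNgt.
apply: (HM (`|M| + 1)); first by apply: le_lt_trans (ler_norm M) _; rewrite ltrDl.
exact: subset_closure.
Qed.

Lemma deriv_support psi psi' N : drv psi psi' ->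
  (forall x, N < `|x| -> psi x = 0) -> forall x, N < `|x| -> psi' x = 0.
Proof.
move=> dpsi supp x xN; have [_ <-] := dpsi x.
rewrite (@near_eq_derive _ _ _ psi (cst 0)) ?derive_cst //.
near=> y; apply: supp; near: y.
by apply: (cvgr_gt `|x|) => //; apply: cvg_norm; exact: cvg_id.
Unshelve. all: by end_near. Qed.

Lemma test_function_deriv psi : test_function psi ->
  test_function (psi^`())%classic.
Proof.
move=> tpsi; have [N N0 supp] := test_function_support tpsi.
have := test_function_drv 0 tpsi; rewrite derive1n0 derive1n1 => dpsi.
split=> [n x|]; first by rewrite -derive1Sn; have [+ _] := tpsi; apply.
apply: (@subclosed_compact _ _ `[- N, N]%classic).
- exact: closed_closure.
- exact: segment_compact.
- rewrite [X in _ `<=` X](iffLR (closure_id _)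
    (@interval_closed R (BLeft (- N)) (BRight N) isT isT)).
  apply: closureS => y /= h; rewrite in_itv /= -ler_norml.
  by apply: contra_neqT h; rewrite -ltNge; exact: (deriv_support dpsi).
Qed.

Lemma Rintegral_supported (D : set R) g : (forall x, ~ D x -> g x = 0) ->
  \int[mu]_x g x = \int[mu]_(x in D) g x.
Proof.
move=> gD; rewrite [RHS]Rintegral_mkcond; congr Rintegral.
apply/funext => x; rewrite patchE; case: ifPn => //.
by rewrite notin_setE => /gD.
Qed.

Lemma test_by_parts f f' psi : drv f f' -> continuous f' -> test_function psi ->
  \int[mu]_x (f x * (psi^`())%classic x) = - \int[mu]_x (f' x * psi x).
Proof.
move=> df cf' tpsi; have [N N0 supp] := test_function_support tpsi.
have dpsi := test_function_drv 0 tpsi; have ddpsi := test_function_drv 1 tpsi.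
rewrite derive1n0 derive1n1 in dpsi; rewrite derive1n1 in ddpsi.
have supp' := deriv_support dpsi supp.
(* The endpoints lie outside the support, which kills the boundary terms. *)
pose L := N + 1; have NL : N < L by rewrite ltrDl.
have out x : ~ `[- L, L]%classic x -> N < `|x|.
  by move=> /= /negP; rewrite in_itv /= -ler_norml -ltNge; exact: lt_trans.
rewrite (@Rintegral_supported `[- L, L]%classic); last first.
  by move=> x /out /supp' ->; rewrite mulr0.
rewrite (@Rintegral_supported `[- L, L]%classic (fun x => f' x * psi x)); last first.
  by move=> x /out /supp ->; rewrite mulr0.
have lr (u u' : R -> R) : drv u u' -> derivable_oo_LRcontinuous u (- L) L.
  move=> du; split.
  - by move=> x _; exact: drv_derivable du.
  - by apply: cvg_at_right_filter; exact: (drv_continuous du).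
  - by apply: cvg_at_left_filter; exact: (drv_continuous du).
have L0 : 0 < L by exact: lt_trans NL.
rewrite (@Rintegration_by_parts R f psi f' (psi^`())%classic (- L) L).
- rewrite (supp L) ?(supp (- L)) ?normrN ?gtr0_norm //.
  by rewrite !mulr0 subrr sub0r.
- by rewrite -subr_gt0 opprK addr_gt0.
- exact: continuous_subspaceT.
- exact: lr df.
- by move=> x _; rewrite (drv_derive1 df).
- by apply: continuous_subspaceT; exact: drv_continuous ddpsi.
- exact: lr dpsi.
- by [].
Qed.

Lemma weak_derivative0 f : continuous f -> is_weak_derivative 0 f f.
Proof.
move=> cf; have lf := continuous_locally_integrable cf.
by split=> // psi _; rewrite expr0 mul1r derive1n0.
Qed.

(** The derivative of a test function is a test function, so that the orders can
    be increased one by one. *)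
Lemma weak_derivativeS n f g g' : is_weak_derivative n f g -> drv g g' ->
  continuous g' -> is_weak_derivative n.+1 f g'.
Proof.
move=> [lf _ fg] dg cg'; split=> //; first exact: continuous_locally_integrable.
move=> psi tpsi; rewrite derive1Sn fg; last exact: test_function_deriv.
by rewrite (test_by_parts dg cg' tpsi) exprS mulN1r mulrN mulNr.
Qed.

(** The bumps of ]a, c[ converge to its indicator and are bounded by 1. *)
Let bump_limit g a c : locally_integrable [set: R] g ->
  (\int[mu]_x (g x * bump a c n x)) @[n --> \oo] -->
  \int[mu]_(x in `]a, c[) g x.
Proof.
move=> lg; have [mg _ _] := lg.
have intg : mu.-integrable `]a, c[ (EFin \o g).
  by apply: integrableS (locally_integrable_itv a c lg) => //; exact: subset_itv_oo_cc.
have mb n : measurable_fun [set: R] (bump a c n).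
  apply: continuous_measurable_fun.
  by have := drv_continuous (test_function_drv 0 (bump_test a c n)); rewrite derive1n0.
have mgb n : measurable_fun `]a, c[ (fun x => (g x * bump a c n x)%:E).
  by apply/measurable_EFinP; apply: measurable_funTS; exact: measurable_funM.
have [] := @dominated_convergence _ _ _ mu `]a, c[ (measurable_itv _)
  (fun n x => (g x * bump a c n x)%:E) (EFin \o g) (fun x => `|(g x)%:E|%E).
- exact: mgb.
- by apply/measurable_EFinP; exact: measurable_funTS.
- apply: aeW => x; rewrite /= in_itv /= => xac.
  apply: cvg_EFin; first by near=> n.
  rewrite -[X in _ --> X]mulr1; apply: cvgMr.
  exact: bump_cvg.
- exact: integrable_norm.
- apply: aeW => x n _; rewrite /= lee_fin normrM -[leRHS]mulr1.
  by rewrite ler_wpM2l // bump_norm_le1.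
have fing : (\int[mu]_(x in `]a, c[) (g x)%:E)%E \is a fin_num.
  by apply: integrable_fin_num.
move=> _ _; rewrite -[X in _ --> X](fineK fing) => /fine_cvgP[_ H].
rewrite (_ : (fun n => _) = fun n => \int[mu]_(x in `]a, c[) (g x * bump a c n x)) //.
apply/funext => n; apply: Rintegral_supported => x /= /negP.
by rewrite in_itv /= => xac; rewrite (bump_out n xac) mulr0.
Unshelve. all: by end_near. Qed.

(** The fundamental lemma of the calculus of variations: the two functions have
    the same integral over all intervals, hence are almost everywhere the
    derivative of the same function. *)
Lemma weak_derivative_unique n f g1 g2 :
  is_weak_derivative n f g1 -> is_weak_derivative n f g2 ->
  {ae mu, forall x, g1 x = g2 x}.
Proof.
move=> [_ l1 H1] [_ l2 H2].
have same a c : \int[mu]_(x in `]a, c[) g1 x = \int[mu]_(x in `]a, c[) g2 x.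
  apply: (@cvg_unique _ _ _ _ _ _ (bump_limit (a := a) (c := c) l1)) => //.
  apply: cvg_trans (bump_limit (a := a) (c := c) l2).
  apply: near_eq_cvg; near=> m; have t := bump_test a c m.
  have := H1 _ t; rewrite (H2 _ t) => /(can_inj (signrMK n)).
  by [].
have intg g a y : locally_integrable [set: R] g ->
    mu.-integrable [set` Interval (BRight a) (BRight y)] (EFin \o g).
  move=> lg; apply: integrableS (locally_integrable_itv a y lg) => //.
  exact: subset_itv_oc_cc.
have intgo g a y : locally_integrable [set: R] g ->
    mu.-integrable [set` Interval (BRight a) (BLeft y)] (EFin \o g).
  move=> lg; apply: integrableS (locally_integrable_itv a y lg) => //.
  exact: subset_itv_oo_cc.
have ae m : {ae mu, forall x : R, - m%:R < x -> g1 x = g2 x}.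
  have F1 := FTC1 (fun y => intg _ (- m%:R) y l1) l1.
  have F2 := FTC1 (fun y => intg _ (- m%:R) y l2) l2.
  move: F1 F2; apply: filterS2; first exact: (ae_filter_ringOfSetsType mu).
  move=> x h1 h2 mx; have [_ <-] := h1 mx; have [_ <-] := h2 mx.
  congr (derive1 _ x); apply/funext => y.
  by rewrite -!Rintegral_itv_bndo_bndc ?same //; exact: intgo.
have := ae_foralln ae; apply: filterS => x Hx.
have [m xm] : exists m : nat, - x < m%:R.
  exists (Num.bound `|x|); have := archi_boundP (normr_ge0 x).
  by apply: le_lt_trans; rewrite -normrN ler_norm.
by apply: (Hx m); rewrite ltrNl.
Unshelve. all: by end_near. Qed.

Lemma weak_derivativeP n f g : is_weak_derivative n f g ->
  is_weak_derivative n f (weak_derivative n f) /\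
  {ae mu, forall x, weak_derivative n f x = g x}.
Proof.
move=> fg; rewrite /weak_derivative; case: xgetP => [h _ fh|/(_ g)//].
by split=> //; exact: weak_derivative_unique fh fg.
Qed.

End WeakDerivative.

(** * Exponentially localised functions in Sobolev spaces *)

Section LocalisedSobolev.
Variable R : realType.
Local Notation mu := (@lebesgue_measure R).
Implicit Types f g : R -> R.

Let cont_wgt2 : continuous (fun x : R => wgt x ^+ 2).
Proof. exact: contX (drv_continuous (@drv_wgt R)). Qed.

(** [wgt ^+ 2] has the primitive [- (expR x + 1)^-1]. *)
Lemma integral_wgt2 : (\int[mu]_x (wgt x ^+ 2)%:E = 1)%E.
Proof.
have e1 (x : R) : expR x + 1 != 0 by rewrite gt_eqF // addr_gt0 ?expR_gt0.
pose F (x : R) := - (expR x + 1)^-1.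
have dF : drv F (fun x => wgt x ^+ 2).
  apply: drv_ext.
    exact: (drvN (drvV e1 (drvD (drv_expR (@drv_id R)) (drv_cst 1)))).
  move=> x /=; rewrite /wgt.
  have -> : expR x = expR (x / 2) ^+ 2 by rewrite -expRM_natl; congr expR; field.
  rewrite expRN; have : expR (x / 2) > 0 by exact: expR_gt0.
  set a := expR (x / 2) => a0; field.
  by rewrite -expr2 !gt_eqF //; have := sqr_ge0 a; lra.
have F0 : F x @[x --> +oo] --> (0 : R).
  apply: (dominated_cvg0 (a := 0) (@cvg_exp_half R)) => x x0.
  rewrite normrN ger0_norm ?invr_ge0 ?addr_ge0 ?expR_ge0 // expRN.
  rewrite lef_pV2 ?posrE ?expR_gt0 ?addr_gt0 ?expR_gt0 //.
  apply: (@le_trans _ _ (expR x)); last by rewrite lerDl.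
  by rewrite ler_expR; lra.
have half : (\int[mu]_(x in `[0%R, +oo[) (wgt x ^+ 2)%:E = 0%:E - (F 0)%:E)%E.
  apply: (@ge0_continuous_FTC2y _ _ F) => //.
  - by move=> x _; exact: sqr_ge0.
  - exact: continuous_subspaceT.
  - by apply: cvg_at_right_filter; exact: (drv_continuous dF).
  - by move=> x _; rewrite (drv_derive1 dF).
have F00 : (2%:E * (0%:E - (F 0)%:E) = 1)%E.
  by rewrite -EFinB -EFinM /F expR0; congr EFin; field.
rewrite ge0_symfun_integralT //; last 2 first.
- by move=> x; exact: sqr_ge0.
- by move=> x; rewrite /= wgt_even.
by rewrite -set_itvcy half F00.
Qed.

Lemma Lnorm2_le f c : measurable_fun [set: R] f -> dom f c ->
  ('N[mu]_2%:E[EFin \o f] <= c%:E)%E.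
Proof.
move=> mf fc; have c0 := dom_ge0 fc.
rewrite unlock /=.
have le2 : (\int[mu]_x (`|(f x)%:E| `^ 2) <= (c ^+ 2)%:E)%E.
  have -> : ((c ^+ 2)%:E = \int[mu]_x ((c ^+ 2)%:E * (wgt x ^+ 2)%:E))%E.
    rewrite ge0_integralZl_EFin ?integral_wgt2 ?mule1 //.
    - by move=> x _; rewrite lee_fin sqr_ge0.
    - by apply/measurable_EFinP; exact: continuous_measurable_fun.
    - exact: sqr_ge0.
  apply: ge0_le_integral => //.
  - by move=> x _; exact: poweR_ge0.
  - under eq_fun do rewrite /= powR_mulrn //.
    apply/measurable_EFinP; apply: measurable_funX.
    exact: measurableT_comp.
  - apply/measurable_EFinP; apply: measurable_funM => //.
    exact: continuous_measurable_fun.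
  - move=> x _; rewrite /= powR_mulrn // lee_fin -exprMn.
    by rewrite lerXn2r ?nnegrE ?mulr_ge0 // ltW ?wgt_gt0.
apply: le_trans (_ : _ <= ((c ^+ 2)%:E `^ 2^-1))%E _.
  apply: gt0_ler_poweR => //; rewrite ?in_itv /= ?leey ?andbT.
    by apply: integral_ge0 => x _; rewrite lee_fin powR_ge0.
  by rewrite lee_fin sqr_ge0.
by rewrite poweR_EFin powR12_sqrt ?sqr_ge0 // sqrtr_sqr ger0_norm.
Qed.

Lemma Lfun2_dom f c : measurable_fun [set: R] f -> dom f c ->
  f \in Lfun mu 2%:E.
Proof.
move=> mf fc; rewrite inE; apply/andP; split; first by rewrite inE.
by rewrite inE /finite_norm /=; apply: le_lt_trans (Lnorm2_le mf fc) (ltry _).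
Qed.

Lemma Lnorm2_ae f g : measurable_fun [set: R] f -> measurable_fun [set: R] g ->
  {ae mu, forall x, f x = g x} ->
  ('N[mu]_2%:E[EFin \o f] = 'N[mu]_2%:E[EFin \o g])%E.
Proof.
move=> mf mg fg; rewrite unlock /=; congr (_ `^ _)%E.
have mp (h : R -> R) : measurable_fun [set: R] h ->
    measurable_fun [set: R] (fun x => `|(h x)%:E| `^ 2)%E.
  move=> mh; under eq_fun do rewrite /= powR_mulrn //.
  by apply/measurable_EFinP; apply: measurable_funX; exact: measurableT_comp.
apply: ae_eq_integral => //; [exact: mp|exact: mp|].
move: fg; apply: filterS; first exact: (ae_filter_ringOfSetsType mu).
by move=> x /= fgx _; rewrite fgx.
Qed.

Lemma sobolev_H_localised (k : nat) (v : nat -> R -> R) (c : R) :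
  (forall n, (n < k)%N -> drv (v n) (v n.+1)) ->
  (forall n, (n <= k)%N -> continuous (v n)) ->
  (forall n, (n <= k)%N -> dom (v n) c) ->
  forall n, (n <= k)%N -> is_weak_derivative n (v 0%N) (v n) /\
    v n \in Lfun mu 2%:E.
Proof.
move=> dv cv domv n nk; split; last first.
  by apply: (@Lfun2_dom _ c); [exact: continuous_measurable_fun (cv n nk)|exact: domv].
elim: n nk => [|n IH] nk; first exact: weak_derivative0 (cv 0%N _).
exact: weak_derivativeS (IH (ltnW nk)) (dv n nk) (cv n.+1 nk).
Qed.

Lemma sobolev_norm1_le f f' c : drv f f' -> continuous f' -> dom f c -> dom f' c ->
  (sobolev_norm 1 f <= (2 * c)%:E)%E.
Proof.
move=> df cf' fc f'c; have c0 := dom_ge0 fc; have cf := drv_continuous df.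
have w0 := weak_derivative0 cf; have w1 := weak_derivativeS w0 df cf'.
have N n (g : R -> R) : is_weak_derivative n f g -> continuous g -> dom g c ->
    ('N[mu]_2%:E[EFin \o weak_derivative n f] <= c%:E)%E.
  move=> wg cg gc; have [[_ [mw _ _] _] wae] := weak_derivativeP wg.
  have mg := continuous_measurable_fun cg.
  by rewrite (Lnorm2_ae mw mg wae); exact: Lnorm2_le.
have sq n (g : R -> R) : is_weak_derivative n f g -> continuous g -> dom g c ->
    ('N[mu]_2%:E[EFin \o weak_derivative n f] ^+ 2 <= (c ^+ 2)%:E)%E.
  move=> wg cg gc; rewrite expe2 expr2 EFinM.
  by apply: lee_pmul; rewrite ?Lnorm_ge0 //; exact: (N n g).
rewrite /sobolev_norm big_ord_recl big_ord_recl big_ord0 adde0.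
have S : ('N[mu]_2%:E[EFin \o weak_derivative 0 f] ^+ 2 +
    'N[mu]_2%:E[EFin \o weak_derivative 1 f] ^+ 2 <= ((2 * c) ^+ 2)%:E)%E.
  apply: (@le_trans _ _ ((c ^+ 2)%:E + (c ^+ 2)%:E)%E).
    by apply: leeD; [exact: (sq _ _ w0)|exact: (sq _ _ w1)].
  by rewrite -EFinD lee_fin; have := sqr_ge0 c; lra.
apply: le_trans (_ : _ <= (((2 * c) ^+ 2)%:E `^ 2^-1))%E _.
  apply: gt0_ler_poweR; rewrite ?in_itv /= ?leey ?andbT //.
  - by apply: adde_ge0; rewrite ?expe2 mule_ge0 // Lnorm_ge0.
  - by rewrite lee_fin sqr_ge0.
by rewrite poweR_EFin powR12_sqrt ?sqr_ge0 // sqrtr_sqr ger0_norm // mulr_ge0.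
Qed.

End LocalisedSobolev.

(** * Solitary waves with small fourth order dispersion *)

Theorem lemma3p1 (R : realType) (p : nat) (hp : (1 <= p)%N) :
  exists (mu0 : R) (phi : R -> R -> R),
    [/\ 0 < mu0,
        forall mu : R, 0 < mu < mu0 ->
          [/\ sobolev_H 4 (phi mu),
              forall x : R, phi mu (- x) = phi mu x &
              kawahara_solution p mu (phi mu)] &
        sobolev_norm 1 (fun x : R => phi mu x - soliton p x)
          @[mu --> 0^'+] --> 0%E].
Proof.
have [mu0 [C [mu0_gt0 C_ge0 prof]]] := profile_exists R hp.
pose sol (mu : R) (v0 : R -> R) := exists v1 v2 v3 v4 : R -> R,
  [/\ [/\ drv v0 v1, drv v1 v2, drv v2 v3, drv v3 v4 & continuous v4],
      exists c, [/\ dom v0 c, dom v1 c, dom v2 c, dom v3 c & dom v4 c],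
      forall x, v0 (- x) = v0 x,
      forall x, mu * v4 x - v2 x + v0 x = nonlin p (v0 x) &
      dom (fun x => v0 x - soliton p x) (C * Num.sqrt mu) /\
      dom (fun x => v1 x - dsoliton p x) (C * Num.sqrt mu)].
pose phi (mu : R) : R -> R := xget (fun=> 0) [set v0 | sol mu v0].
have phiP mu : 0 < mu < mu0 -> sol mu (phi mu).
  move=> /prof[v0 Hv0]; rewrite /phi.
  by case: xgetP => [v _ //|/(_ v0)]; case; exact: Hv0.
exists mu0, phi; split=> // [mu /phiP|].
  move=> [v1 [v2 [v3 [v4 [[d0 d1 d2 d3 c4] [c [D0 D1 D2 D3 D4]] ev eqn _]]]]].
  pose v n := nth v4 [:: phi mu; v1; v2; v3] n.
  have weak : forall n, (n <= 4)%N ->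
      is_weak_derivative n (phi mu) (v n) /\ v n \in Lfun (@lebesgue_measure R) 2%:E.
    apply: (@sobolev_H_localised R 4 v c).
    - by case=> [|[|[|[|]]]].
    - case=> [|[|[|[|[|]]]]] // _; first exact: drv_continuous d0.
      + exact: drv_continuous d1.
      + exact: drv_continuous d2.
      + exact: drv_continuous d3.
    - by case=> [|[|[|[|[|]]]]].
  split=> //.
    split=> [|n n4]; first by have [] := weak 0%N isT.
    by exists (v n); exact: weak.
  have [_ w4] := weak_derivativeP (weak 4%N isT).1.
  have [_ w2] := weak_derivativeP (weak 2%N isT).1.
  rewrite /kawahara_solution; move: w4 w2; apply: filterS2.
    exact: (ae_filter_ringOfSetsType lebesgue_measure).
  by move=> x -> ->; exact: eqn.
have near_le : \forall mu \near (0 : R)^'+,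
    (0 <= sobolev_norm 1 (fun x : R => phi mu x - soliton p x)%R
       <= (2 * (C * Num.sqrt mu))%R%:E)%E.
  near=> mu; have mu_small : 0 < mu < mu0.
    apply/andP; split; first by near: mu; exact: nbhs_right_gt.
    by near: mu; exact: nbhs_right_lt.
  have [v1 [v2 [_ [_ [[d0 d1 _ _ _] _ _ _ [h0 h1]]]]]] := phiP mu mu_small.
  rewrite poweR_ge0 /=; apply: sobolev_norm1_le h0 h1.
    exact: drvB d0 (@drv_soliton R p hp).
  exact: contB (drv_continuous d1) (drv_continuous (@drv_dsoliton R p hp)).
apply: (squeeze_cvge near_le); first exact: cvg_cst.
apply: cvg_EFin; first by near=> mu.
have : (2 * (C * Num.sqrt mu)) @[mu --> (0 : R)^'+] --> 2 * (C * Num.sqrt 0).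
  apply: cvgMr; apply: cvgMr; apply: cvg_at_right_filter.
  exact: sqrt_continuous.
by rewrite sqrtr0 !mulr0.
Unshelve. all: by end_near. Qed.
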